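(* Let $\alpha,L>0$ and consider the sparse graphon model with $W_0\in\Sigma(\alpha,L)$ and $4/n<\rho_n\le 1$. Set $$k=\Big\lceil(\rho_n^{1/2}n)^{\frac{1}{1+\alpha\wedge1}}\Big\rceil\ \text{ if }\rho_n\ge n^{(\alpha\wedge1)-1},\qquad k=\Big\lceil(\rho_n n)^{\frac{1}{2(\alpha\wedge1)}}\Big\rceil\ \text{ if }\rho_n<n^{(\alpha\wedge1)-1}.$$ (i) Assume that $\rho_n\ge n^{-\frac{2(\alpha\wedge1)}{1+2(\alpha\wedge1)}}\big(\log(n\rho_n)\big)^{\frac{2(1+\alpha\wedge1)}{1+2(\alpha\wedge1)}}$ and that there exists an integer $n_0\ge2$ such that $k=\lfloor n/n_0\rfloor$. Then there exists a positive constant $C$ depending only on $L$ and $\alpha$ such that the least squares estimator $\widehat{\boldsymbol\Theta}$ constructed with this choice of $k$ and $n_0$ satisfies $$\mathbb E\left[\frac1{n^2}\|\widehat{\boldsymbol\Theta}-\boldsymbol\Theta_0\|_F^2\right]\le C\left\{\rho_n^{\frac{2+\alpha\wedge1}{1+\alpha\wedge1}}n^{-\frac{2(\alpha\wedge1)}{1+\alpha\wedge1}}+\frac{\rho_n\log(\rho_n n)}{n}\right\}.$$ (ii) Assume that $1\ge r\ge\rho_n\ge c_0n^{-1}$, where $c_0>0$ is an absolute constant. Then there exists a positive constant $C$ depending only on $L$ and $\alpha$ (and $c_0$) such that the restricted least squares estimator $\widehat{\boldsymbol\Theta}^r$ with this choice of $k$ satisfies $$\mathbb E\left[\frac1{n^2}\|\widehat{\boldsymbol\Theta}^r-\boldsymbol\Theta_0\|_F^2\right]\le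 C\left\{r^{\frac{2+\alpha\wedge1}{1+\alpha\wedge1}}n^{-\frac{2(\alpha\wedge1)}{1+\alpha\wedge1}}+\frac{r\log(\rho_n n)}{n}\right\}.$$
   Context: A graphon is a symmetric measurable function $W:[0,1]^2\to[0,1]$. Sparse graphon model: $W_0$ is a graphon, $\xi_1,\dots,\xi_n$ are unobserved i.i.d. uniform on $[0,1]$, $\boldsymbol\Theta_0$ is the symmetric $n\times n$ matrix with zero diagonal and $(\boldsymbol\Theta_0)_{ij}=\rho_nW_0(\xi_i,\xi_j)$ for $j<i$. Conditionally on $(\xi_1,\dots,\xi_n)$, the observations $\boldsymbol A'=(\boldsymbol A_{ij},1\le j<i\le n)$ are independent Bernoulli with parameters $(\boldsymbol\Theta_0)_{ij}$. $\mathbb E$ is expectation over the joint distribution of $(\xi_i)$ and $\boldsymbol A'$. Hölder class: $\Sigma(\alpha,L)$ is the set of $W:[0,1]^2\to[0,1]$ such that $|W(x',y')-\mathcal P_{\ell}((x,y),(x'-x,y'-y))|\le L(|x'-x|^{\alpha-\ell}+|y'-y|^{\alpha-\ell})$ for all $(x',y'),(x,y)\in[0,1]^2$, where $\ell$ is the maximal integer strictly less than $\alpha$ and $(x',y')\mapsto\mathcal P_\ell((x,y),(x'-x,y'-y))$ is the Taylor polynomial of $W$ of degree $\ell$ at $(x,y)$. Every such $W$ satisfies $|W(x',y')-W(x,y)|\le M(|x'-x|^{\alpha\wedge1}+|y'-y|^{\alpha\wedge1})$ with $M$ depending only on $\alpha,L$. Estimators: $\mathcal Z_{n,k,n_0}$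 is the set of maps $z:\{1,\dots,n\}\to\{1,\dots,k\}$ all of whose fibers have at least $n_0$ elements; $\mathcal Z_{n,k}=\mathcal Z_{n,k,1}$. Let $L(\boldsymbol Q,z)=\sum_{1\le j<i\le n}(\boldsymbol A_{ij}-\boldsymbol Q_{z(i)z(j)})^2$. Least squares estimator $\widehat{\boldsymbol\Theta}$: take a minimizer $(\widehat{\boldsymbol Q},\hat z)$ of $L$ over symmetric real $k\times k$ matrices $\boldsymbol Q$ and $z\in\mathcal Z_{n,k,n_0}$, and let $\widehat{\boldsymbol\Theta}$ be the symmetric matrix with zero diagonal and $\widehat{\boldsymbol\Theta}_{ij}=\widehat{\boldsymbol Q}_{\hat z(i)\hat z(j)}$, $i>j$. Restricted least squares estimator $\widehat{\boldsymbol\Theta}^r$, $r\in(0,1]$: the same with the minimum taken over symmetric $\boldsymbol Q$ with $\max_{a,b}|\boldsymbol Q_{ab}|\le r$ and $z\in\mathcal Z_{n,k}$. $\|\cdot\|_F$ is the Frobenius norm; $\lfloor\cdot\rfloor$, $\lceil\cdot\rceil$ are the usual floor and ceiling; $a\wedge b=\min(a,b)$. *)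

(* Defs.v *)
From mathcomp Require Import all_boot all_order all_algebra.
From mathcomp Require Import all_classical all_reals all_analysis.

Set Implicit Arguments.
Unset Strict Implicit.
Unset Printing Implicit Defensive.

Import Order.TTheory GRing.Theory Num.Theory.
Import numFieldNormedType.Exports.

Local Open Scope classical_set_scope.
Local Open Scope ring_scope.

(* Functions on the unit square are represented by total functions on R * R;
   nothing below depends on their values off the square. *)

Definition maps_square_to_unit (R : realType) (W : R * R -> R) : Prop :=
  forall x y, x \in `[0, 1] -> y \in `[0, 1] -> W (x, y) \in `[0, 1].

Record graphon (R : realType) (W : R * R -> R) : Prop := Graphon {
  graphon_unit : maps_square_to_unit W;
  graphon_sym : forall x y, x \in `[0, 1] -> y \in `[0, 1] ->
    W (x, y) = W (y, x);
  graphon_measurable : measurable_fun (`[0, 1] `*` `[0, 1] : set (R * R)) W }.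

(* Derivative relative to [0, 1]: two-sided at interior points, one-sided at
   the endpoints 0 and 1. *)
Definition is_derive01 (R : realType) (f : R -> R) (x l : R) : Prop :=
  (f t - f x) / (t - x) @[t --> within `[0, 1] x^'] --> l.

(* On the unit square, [D i j] with [i + j <= l] is the partial derivative of
   order [i] in the first variable and [j] in the second one, all orders of
   differentiation being required to exist and to agree.  This determines
   [D i j] on the square. *)
Record partial_derivatives (R : realType) (l : nat) (W : R * R -> R)
    (D : nat -> nat -> R * R -> R) : Prop := PartialDerivatives {
  pderiv00 : forall x y, x \in `[0, 1] -> y \in `[0, 1] ->
    D 0%N 0%N (x, y) = W (x, y);
  pderivSl : forall i j, (i + j < l)%N ->
    forall x y, x \in `[0, 1] -> y \in `[0, 1] ->
    is_derive01 (fun t => D i j (t, y)) x (D i.+1 j (x, y));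
  pderivSr : forall i j, (i + j < l)%N ->
    forall x y, x \in `[0, 1] -> y \in `[0, 1] ->
    is_derive01 (fun t => D i j (x, t)) y (D i j.+1 (x, y)) }.

Definition taylor_poly (R : realType) (l : nat) (D : nat -> nat -> R * R -> R)
    (p h : R * R) : R :=
  \sum_(i < l.+1) \sum_(j < l.+1 | (i + j <= l)%N)
    D i j p / (i`! * j`!)%:R * h.1 ^+ i * h.2 ^+ j.

Definition strict_floor (R : realType) (alpha : R) : nat :=
  `|Num.ceil alpha|%N.-1.

Lemma strict_floorP (R : realType) (alpha : R) : 0 < alpha ->
  (strict_floor alpha)%:R < alpha /\
  forall m : nat, m%:R < alpha -> (m <= strict_floor alpha)%N.
Proof.
move=> a0; have := ceil_gt0 alpha; rewrite a0.
have := ceil_itv alpha; have cm m := ceil_gt_int alpha (Posz m).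
rewrite /strict_floor; move: cm.
case: (Num.ceil alpha) => [[|c]|c] //= cm /andP[ca _] _; split.
  by move: ca; rewrite -addn1 PoszD addrK.
by move=> m; have := cm m; rewrite -pmulrn => <-.
Qed.

Definition holder_class (R : realType) (alpha L : R) (W : R * R -> R) : Prop :=
  let l := strict_floor alpha in
  maps_square_to_unit W /\
  exists2 D, partial_derivatives l W D &
    forall x y x' y',
      x \in `[0, 1] -> y \in `[0, 1] -> x' \in `[0, 1] -> y' \in `[0, 1] ->
      `|W (x', y') - taylor_poly l D (x, y) (x' - x, y' - y)|
        <= L * (`|x' - x| `^ (alpha - l%:R) + `|y' - y| `^ (alpha - l%:R)).

Definition edge (n : nat) := {ij : 'I_n * 'I_n | (ij.2 < ij.1)%N}.

(* A value of the observations A' = (A_ij, j < i). *)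
Definition data (n : nat) := {ffun edge n -> bool}.

Definition sym_hollow (R : realType) (n : nat) (f : 'I_n -> 'I_n -> R) : 'M[R]_n :=
  \matrix_(i, j) (if (j < i)%N then f i j else if (i < j)%N then f j i else 0).

Definition Theta0 (R : realType) (n : nat) (rho : R) (W : R * R -> R)
    (x : 'I_n -> R) : 'M[R]_n :=
  sym_hollow (fun i j => rho * W (x i, x j)).

Definition sigma_generated d (T : measurableType d) (R : realType) (n : nat)
    (X : 'I_n -> T -> R) : set (set T) :=
  <<s [set E | exists i, exists2 B, measurable B & E = X i @^-1` B] >>.

(* f is a version of the conditional probability P(E | F). *)
Definition cond_prob_version d (T : measurableType d) (R : realType)
    (P : probability T R) (F : set (set T)) (E : set T) (f : T -> R) : Prop :=
  (forall B, measurable B -> F (f @^-1` B)) /\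
  (forall G, F G -> P (G `&` E) = (\int[P]_(w in G) (f w)%:E)%E).

(* The last clause says that, conditionally on xi, the observations are
   independent Bernoulli variables with parameters (Theta0)_ij, j < i: their
   conditional joint mass function is the product of the Bernoulli ones. *)
Record sparse_graphon_model (R : realType) (n : nat) (rho : R) (W : R * R -> R)
    d (T : measurableType d) (P : probability T R)
    (xi : 'I_n -> {RV P >-> R}) (A : T -> data n) : Prop := SparseGraphonModel {
  xi_unit : forall i w, xi i w \in `[0, 1];
  xi_uniform : forall i B, measurable B ->
    distribution P (xi i) B = uniform_prob (@ltr01 R) B;
  xi_independent : forall B : 'I_n -> set R, (forall i, measurable (B i)) ->
    P (\bigcap_i (xi i @^-1` B i)) = (\prod_i P (xi i @^-1` B i))%E;
  A_measurable : forall e, measurable_fun setT (fun w => A w e);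
  A_given_xi : forall a : data n,
    cond_prob_version P (sigma_generated (fun i => xi i : T -> R))
      [set w | A w = a]
      (fun w => \prod_(e : edge n)
         bernoulli_pmf (Theta0 rho W (fun i => xi i w) (val e).1 (val e).2)
                       (a e)) }.

(* Z_{n,k,n0}; the set Z_{n,k} is Z_{n,k,1}. *)
Definition assignments (n k n0 : nat) : {set {ffun 'I_n -> 'I_k}} :=
  [set z : {ffun 'I_n -> 'I_k} |
    [forall b, (n0 <= #|[set i | z i == b]|)%N]]%SET.

Definition ls_loss (R : realType) (n k : nat) (a : data n) (Q : 'M[R]_k)
    (z : {ffun 'I_n -> 'I_k}) : R :=
  \sum_(e : edge n) ((a e)%:R - Q (z (val e).1) (z (val e).2)) ^+ 2.

Definition ls_minimizer (R : realType) (n k : nat) (Qs : set 'M[R]_k)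
    (Zs : {set {ffun 'I_n -> 'I_k}}) (a : data n)
    (Qz : 'M[R]_k * {ffun 'I_n -> 'I_k}) : Prop :=
  [/\ Qs Qz.1, Qz.2 \in Zs &
      forall Q z, Qs Q -> z \in Zs -> ls_loss a Qz.1 Qz.2 <= ls_loss a Q z].

Definition sym_matrices (R : realType) (k : nat) : set 'M[R]_k :=
  [set Q | Q^T = Q].

Definition bounded_sym_matrices (R : realType) (k : nat) (r : R) : set 'M[R]_k :=
  [set Q | Q^T = Q /\ forall a b, `|Q a b| <= r].

(* A least squares estimator is a choice of a minimizer for each value of the
   data. *)
Definition is_least_squares (R : realType) (n k n0 : nat)
    (est : data n -> 'M[R]_k * {ffun 'I_n -> 'I_k}) : Prop :=
  forall a, ls_minimizer (@sym_matrices R k) (assignments n k n0) a (est a).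

Definition is_restricted_least_squares (R : realType) (n k : nat) (r : R)
    (est : data n -> 'M[R]_k * {ffun 'I_n -> 'I_k}) : Prop :=
  forall a, ls_minimizer (@bounded_sym_matrices R k r) (assignments n k 1) a (est a).

Definition Theta_hat (R : realType) (n k : nat)
    (Qz : 'M[R]_k * {ffun 'I_n -> 'I_k}) : 'M[R]_n :=
  sym_hollow (fun i j => Qz.1 (Qz.2 i) (Qz.2 j)).

Definition frobenius_norm (R : realType) (m n : nat) (M : 'M[R]_(m, n)) : R :=
  Num.sqrt (\sum_i \sum_j M i j ^+ 2).

Definition mean_sq_error (R : realType) (n k : nat) (rho : R) (W : R * R -> R)
    d (T : measurableType d) (P : probability T R)
    (xi : 'I_n -> {RV P >-> R}) (A : T -> data n)
    (est : data n -> 'M[R]_k * {ffun 'I_n -> 'I_k}) : \bar R :=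
  ('E_P[fun w => (n%:R ^- 2 *
    frobenius_norm (Theta_hat (est (A w)) - Theta0 rho W (fun i => xi i w)) ^+ 2)%R])%E.

Definition num_blocks (R : realType) (alpha rho : R) (n : nat) : nat :=
  let a := Num.min alpha 1 in
  if n%:R `^ (a - 1) <= rho
  then `|Num.ceil ((rho `^ (1 / 2) * n%:R) `^ (1 / (1 + a)))|%N
  else `|Num.ceil ((rho * n%:R) `^ (1 / (2 * a)))|%N.

Definition error_rate (R : realType) (alpha rho s : R) (n : nat) : R :=
  let a := Num.min alpha 1 in
  s `^ ((2 + a) / (1 + a)) * n%:R `^ (- (2 * a / (1 + a)))
  + s * ln (rho * n%:R) / n%:R.

(* Main.v *)
(** Fix the latent points and let [theta] be the vector of the means of the edges,
    [W] the noise, [r] a bound on the entries.  Comparing the estimator with a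
    reference block matrix [theta*] bounds [|thetahat - theta|^2 / 2] by the bias
    [|theta* - theta|^2], a linear term of mean zero, and the gain
    [2 <W, u> - |u|^2 / 2] at [u = thetahat - theta].  For a fixed assignment the
    gain is a sum over the blocks of concave quadratics of one variable, hence is
    attained, up to [O(r)] per block, on a grid of step [sqrt (r / N)] centred at the
    mean of [theta] over the block, [N] being its number of edges.  Since
    [E exp (gain / (32 r)) <= exp (- |u|^2 / (128 r))], the sum over a grid is a
    Gaussian sum bounded by a constant, and a union bound over the [k ^ n]
    assignments gives a stochastic term of order [r (n log k + k^2)].

    The unrestricted estimator has block averages as entries.  By a Chernoff bound
    over pairs of subsets, all the averages over pairs of sets of at least [n0] points
    are [O(rho)] outside an event of probability at most [n ^ -2]; this uses
    [log k = O(rho n0)], which is what the lower bound on [rho] says.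

    For the bias, a Hoelder graphon is Lipschitz of exponent [min alpha 1] with a
    constant depending on [alpha] and [L] only: Taylor polynomials are bounded on
    intervals of length 1/2, hence so are the partial derivatives of order one.
    In (ii) the latent points are grouped in bins of width [1 / k], a partition which
    is then refined into exactly [k] classes.  In (i) the classes are made of
    consecutive order statistics; their diameters are [O(1 / k)] as soon as all the
    bins of width proportional to [1 / k] contain [2 n0] points. *)

Require Import Defs.
From mathcomp Require Import all_boot all_order all_algebra.
From mathcomp Require Import all_classical all_reals all_analysis.
From mathcomp Require Import measurable_realfun.
From mathcomp Require Import ring lra zify.
Set Implicit Arguments.
Unset Strict Implicit.
Unset Printing Implicit Defensive.
Import Order.TTheory GRing.Theory Num.Theory.
Import numFieldNormedType.Exports.
Local Open Scope classical_set_scope.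
Local Open Scope ring_scope.

(** * Bernoulli noise *)

(** Since [expR (- v) >= 1 - v], it suffices that [(1 + v + 2 * v ^+ 2) * (1 - v) = 1 + v ^+ 2 * (1
    - 2 * v)] is at least 1. *)
Lemma expR_le_quadratic (R : realType) (v : R) :
  v <= 1 / 2 -> expR v <= 1 + v + 2 * v ^+ 2.
Proof.
move=> hv.
have e1 : 1 - v <= expR (- v) by exact: expR_ge1Dx.
have e2 : expR v * expR (- v) = 1 by rewrite expRxMexpNx_1.
have e3 := expR_gt0 v.
have v0 : 0 < 1 - v by lra.
rewrite -(ler_pM2r v0); apply: (@le_trans _ _ 1).
  by rewrite -[leRHS]e2 ler_wpM2l // ltW.
have := sqr_ge0 v; nra.
Qed.

Definition bernoulli_weight (R : realType) (E : finType) (th : E -> R)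
  (a : {ffun E -> bool}) : R := \prod_e bernoulli_pmf (th e) (a e).

Lemma bernoulli_weight_prod (R : realType) (E : finType) (th : E -> R)
    (g : E -> bool -> R) :
  \sum_a bernoulli_weight th a * \prod_e g e (a e) =
  \prod_e (th e * g e true + (1 - th e) * g e false).
Proof.
transitivity (\prod_e \sum_(b : bool) bernoulli_pmf (th e) b * g e b); last first.
  by apply: eq_bigr => e _; rewrite big_bool.
rewrite bigA_distr_bigA; apply: eq_bigr => a _.
by rewrite /bernoulli_weight -big_split.
Qed.

Lemma bernoulli_weight_ge0 (R : realType) (E : finType) (th : E -> R) a :
  (forall e, 0 <= th e <= 1) -> 0 <= bernoulli_weight th a.
Proof.
move=> h; apply: prodr_ge0 => e _; have /andP[h0 h1] := h e.
by rewrite /bernoulli_pmf; case: (a e); lra.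
Qed.

Lemma bernoulli_weight_sum (R : realType) (E : finType) (th : E -> R) :
  \sum_a bernoulli_weight th a = 1.
Proof.
transitivity (\sum_a bernoulli_weight th a * \prod_(e : E) (1 : R)).
  by apply: eq_bigr => a _; rewrite big1 // mulr1.
rewrite (bernoulli_weight_prod th (fun _ _ => 1)).
by apply: big1 => e _; rewrite !mulr1 addrC subrK.
Qed.

Lemma bernoulli_weight_noise_mean (R : realType) (E : finType) (th v : E -> R) :
  \sum_a bernoulli_weight th a * \sum_e v e * ((a e)%:R - th e) = 0.
Proof.
under eq_bigr do rewrite big_distrr /=.
rewrite exchange_big /= big1 // => e _.
(* This product keeps the noise of the single coordinate [e], whose factor is [th e * (1 - th e) -
   (1 - th e) * th e = 0]. *)
have := bernoulli_weight_prod th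
  (fun e' b => if e' == e then b%:R - th e else 1).
rewrite [RHS](bigD1 e) //= eqxx.
rewrite (_ : th e * _ + _ = 0) ?mul0r; last by rewrite /=; ring.
move=> h; rewrite -[RHS](mulr0 (v e)) -[X in _ = _ * X]h mulr_sumr.
apply: eq_bigr => a _; rewrite (bigD1 e) //= eqxx.
rewrite big1 ?mulr1; last by move=> i /negPf ->.
by ring.
Qed.

(** By independence the mean is a product of centred Bernoulli moment generating functions, each
    bounded through [1 + x <= expR x]. The variance proxy keeps the factor [th e]: this is how
    sparsity enters the rates. *)
Lemma bernoulli_weight_exp_noise (R : realType) (E : finType) (th v : E -> R) :
  (forall e, 0 <= th e <= 1) -> (forall e, v e <= 1 / 2) ->
  \sum_a bernoulli_weight th a * expR (\sum_e v e * ((a e)%:R - th e))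
  <= expR (2 * \sum_e th e * v e ^+ 2).
Proof.
move=> hth hv.
under eq_bigr do rewrite expR_sum.
rewrite (bernoulli_weight_prod th (fun e b => expR (v e * (b%:R - th e)))).
rewrite mulr_sumr expR_sum; apply: ler_prod => e _.
have /andP[t0 t1] := hth e.
have e0 x := ltW (expR_gt0 (x : R)).
apply/andP; split.
  by rewrite addr_ge0 ?mulr_ge0 ?subr_ge0.
have -> : v e * (true%:R - th e) = v e + - (th e * v e) by rewrite /=; ring.
have -> : v e * (false%:R - th e) = - (th e * v e) by rewrite /=; ring.
rewrite expRD.
have -> : th e * (expR (v e) * expR (- (th e * v e))) + (1 - th e) * expR (- (th e * v e))
  = (1 + th e * (expR (v e) - 1)) * expR (- (th e * v e)) by ring.
apply: (@le_trans _ _ (expR (th e * (expR (v e) - 1)) * expR (- (th e * v e)))).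
  by rewrite ler_wpM2r // expR_ge1Dx.
rewrite -expRD ler_expR.
have := expR_le_quadratic (hv e); nra.
Qed.

(* [f t - (linear interpolation of f)] is [N / 2 * (t - t0) * (t1 - t)] for a
   quadratic [f] with leading coefficient [- N / 2]. *)
Lemma quadratic_grid_bound (R : realType) (N A r x : R) (m : nat) :
  0 <= N -> 0 < r -> (0 < m)%N -> r * N <= m%:R ^+ 2 -> `|x| <= 2 * r ->
  exists2 j : nat, (j <= 4 * m)%N &
    let y := (j%:R - 2 * m%:R) * (r / m%:R) in
    A * x - N / 2 * x ^+ 2 <= A * y - N / 2 * y ^+ 2 + r / 8.
Proof.
move=> N0 r0 m0 hN; rewrite ler_norml => /andP[x1 x2].
have m0' : 0 < m%:R :> R by rewrite ltr0n.
set d := r / m%:R.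
have d0 : 0 < d by rewrite divr_gt0.
have md : m%:R * d = r by rewrite mulrC divfK // gt_eqF.
have Nd : N * d ^+ 2 <= r.
  rewrite -(ler_pM2r m0') -(ler_pM2r m0') -mulrA -mulrA -expr2.
  rewrite (_ : N * d ^+ 2 * m%:R ^+ 2 = N * (m%:R * d) ^+ 2); last by ring.
  by rewrite md; nra.
set t := (x + 2 * r) / d.
have t0 : 0 <= t by apply: divr_ge0; [lra|exact: ltW].
have td : t * d = x + 2 * r by rewrite divfK // gt_eqF.
have /andP[j1 j2] := truncn_itv t0.
set j := Num.trunc t in j1 j2.
have [jm|jm] := leqP (4 * m) j.
  exists (4 * m)%N => //=.
  have jm' : 4 * m%:R <= j%:R :> R by rewrite -natrM ler_nat.
  have -> : ((4 * m)%:R - 2 * m%:R) * d = 2 * r by rewrite natrM; lra.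
  have -> : x = 2 * r by nra.
  by rewrite lerDl divr_ge0 // ltW.
pose y0 := (j%:R - 2 * m%:R) * d.
have y1E : (j.+1%:R - 2 * m%:R) * d = y0 + d by rewrite /y0 -natr1; ring.
have xy0 : y0 <= x by rewrite /y0; nra.
have xy1 : x <= y0 + d by rewrite -y1E; nra.
(* Two lengths that sum to [d] have a product at most [d ^+ 2 / 4], and [N * d ^+ 2 <= r]. *)
have key : N * (x - y0) * (y0 + d - x) <= r / 4.
  have h : (x - y0) * (y0 + d - x) <= d ^+ 2 / 4.
    by have := sqr_ge0 (2 * (x - y0) - d); nra.
  rewrite -mulrA; apply: (le_trans (ler_wpM2l N0 h)); lra.
pose f z := A * z - N / 2 * z ^+ 2.
have interp : d * f x = (y0 + d - x) * f y0 + (x - y0) * f (y0 + d)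
   + d * (N * (x - y0) * (y0 + d - x) / 2) by rewrite /f; field.
(* [f x] exceeds a convex combination of the values at the two neighbours by at most [r / 8], so the
   neighbour with the larger value will do. *)
have [h|h] := leP (f y0) (f (y0 + d)).
  exists j.+1 => //=; rewrite y1E -/(f x) -/(f (y0 + d)).
  have h1 : (y0 + d - x) * f y0 <= (y0 + d - x) * f (y0 + d).
    by rewrite ler_wpM2l //; lra.
  rewrite -(ler_pM2l d0) interp; move: (f y0) (f (y0 + d)) h1 => u v h1.
  have := ler_wpM2l (ltW d0) key; move: (N * _ * _) => w; nra.
exists j; first exact: ltnW.
rewrite /= -/y0 -/(f x) -/(f y0).
have h1 : (x - y0) * f (y0 + d) <= (x - y0) * f y0.
  by rewrite ler_wpM2l ?(ltW h) //; lra.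
rewrite -(ler_pM2l d0) interp; move: (f y0) (f (y0 + d)) h1 => u v h1.
have := ler_wpM2l (ltW d0) key; move: (N * _ * _) => w; nra.
Qed.

(* Twice a geometric series, plus the 5 points of the coarsest grid ([m = 1]). *)
Definition grid_const (R : realType) : R := 2 / (1 - expR (- (512^-1))) + 5.

Lemma geometric_sum_le (R : realType) (q : R) n :
  0 <= q -> q < 1 -> \sum_(i < n) q ^+ i <= 1 / (1 - q).
Proof.
move=> q0 q1; have q1' : 0 < 1 - q by lra.
have := subrX1 q n; rewrite ler_pdivlMr //.
have := exprn_ge0 n q0; nra.
Qed.

(** When [m ^ 2 <= 4 * s], the term at distance [i] from the central index [2 * m] is at most
    [expR (- i ^ 2 / 512) <= q ^ i], which leaves two geometric series. When [m = 1] there are five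
    terms, each at most 1. *)
Lemma grid_sum_le (R : realType) (s : R) (m : nat) :
  0 <= s -> (0 < m)%N -> (m = 1)%N \/ m%:R ^+ 2 <= 4 * s ->
  \sum_(j < (4 * m).+1) expR (- (((j : nat)%:R - 2 * m%:R) / m%:R) ^+ 2 * s / 128)
  <= grid_const R.
Proof.
move=> s0 m0 hm; have m0' : 0 < m%:R :> R by rewrite ltr0n.
set q := expR (- (512^-1)) : R.
have q0 : 0 < q by exact: expR_gt0.
have q1 : q < 1 by rewrite expR_lt1; lra.
case: hm => [m1|hm].
  apply: (@le_trans _ _ (\sum_(j < (4 * m).+1) 1)).
    apply: ler_sum => j _; rewrite -[leRHS]expR0 ler_expR.
    have := sqr_ge0 (((j : nat)%:R - 2 * m%:R) / m%:R : R); nra.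
  rewrite sumr_const card_ord m1 /grid_const -/q.
  have : 0 <= 2 / (1 - q) by apply: divr_ge0; lra.
  by move=> h; rewrite (_ : 1 *+ (4 * 1).+1 = 5) ?lerDr.
have qX i : expR (- ((i%:R : R) ^+ 2) / 512) <= q ^+ i.
  rewrite /q -expRM_natl ler_expR.
  have : i%:R <= i%:R ^+ 2 :> R by rewrite -natrX ler_nat; nia.
  lra.
have step (j : nat) : expR (- ((j%:R - 2 * m%:R) / m%:R) ^+ 2 * s / 128) <=
    expR (- ((j%:R - 2 * m%:R : R) ^+ 2) / 512).
  rewrite ler_expR expr_div_n.
  have e : (j%:R - 2 * m%:R) ^+ 2 / m%:R ^+ 2 * m%:R ^+ 2 = (j%:R - 2 * m%:R : R) ^+ 2.
    by rewrite divfK // expf_neq0 // gt_eqF.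
  have : 0 <= (j%:R - 2 * m%:R) ^+ 2 / m%:R ^+ 2 :> R.
    by rewrite divr_ge0 ?sqr_ge0.
  nra.
apply: (@le_trans _ _ (\sum_(j < (4 * m).+1) expR (- (((j : nat)%:R - 2 * m%:R : R) ^+
    2) / 512))).
  by apply: ler_sum => j _.
rewrite -(big_mkord xpredT (fun j => expR (- ((j%:R - 2 * m%:R : R) ^+ 2) / 512))).
rewrite (@big_cat_nat _ _ _ (2 * m)) /=; [|by []|by lia].
apply: (@le_trans _ _ (1 / (1 - q) + 1 / (1 - q))); last first.
  by rewrite /grid_const -/q; lra.
apply: lerD.
  apply: le_trans (geometric_sum_le (2 * m).+1 (ltW q0) q1).
  rewrite -(big_mkord xpredT (fun i => q ^+ i)) big_nat_rev /= add0n.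
  rewrite [leRHS]big_nat_recl //= -[leLHS]add0r; apply: lerD; first by rewrite expr0.
  rewrite [leLHS]big_nat [leRHS]big_nat; apply: ler_sum => i /andP[_ hi].
  apply: le_trans (qX i.+1).
  by rewrite natrB ?natrM; [rewrite ler_expR; lra|lia].
rewrite -{1}[(2 * m)%N]add0n big_addn.
apply: le_trans (geometric_sum_le ((4 * m).+1 - 2 * m) (ltW q0) q1).
rewrite -(big_mkord xpredT (fun i => q ^+ i)).
apply: ler_sum => i _; apply: le_trans (qX i).
by rewrite natrD natrM ler_expR; lra.
Qed.

Lemma grid_const_ge1 (R : realType) : 1 <= grid_const R.
Proof.
rewrite /grid_const; set q := expR _.
have q1 : q < 1 by rewrite expR_lt1; lra.
suff : 0 <= 2 / (1 - q) by lra.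
by apply: divr_ge0; lra.
Qed.

(** * The oracle inequality *)

Definition centred_gain (R : realType) (E : finType) (th : E -> R)
    (a : {ffun E -> bool}) (v : E -> R) : R :=
  \sum_e (2 * ((a e)%:R - th e) * v e - v e ^+ 2 / 2).

(** The scale [32 * r] gives the noise the coefficients [v e / (16 * r)], which are at most 1/2.
    With [s] the sum of the squares, the exponential moment of the noise costs [s / (128 * r)], half
    of the [s / (64 * r)] provided by the quadratic part. *)
Lemma centred_gain_exp (R : realType) (E : finType) (th v : E -> R) (r : R) :
  0 < r -> (forall e, 0 <= th e <= 1) -> (forall e, th e <= r) ->
  (forall e, v e <= 8 * r) ->
  \sum_a bernoulli_weight th a * expR (centred_gain th a v / (32 * r)) <=
  expR (- (\sum_e v e ^+ 2) / (128 * r)).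
Proof.
move=> r0 th01 thr vr.
set s := \sum_e v e ^+ 2.
have := @bernoulli_weight_exp_noise R E th (fun e => v e / (16 * r)) th01.
have h1 e : v e / (16 * r) <= 1 / 2.
  by rewrite ler_pdivrMr ?mulr_gt0 //; have := vr e; lra.
move=> /(_ h1) h.
have gE a : expR (centred_gain th a v / (32 * r)) = expR (- s / (64 * r)) *
    expR (\sum_e v e / (16 * r) * ((a e)%:R - th e)).
  rewrite -expRD; congr expR; rewrite /centred_gain /s -sumrN !mulr_suml -big_split /=.
  by apply: eq_bigr => e _; field; rewrite gt_eqF.
under eq_bigr do rewrite gE mulrCA.
rewrite -mulr_sumr; apply: le_trans (ler_wpM2l (ltW (expR_gt0 _)) h) _.
rewrite -expRD ler_expR.
have h2 : \sum_e th e * (v e / (16 * r)) ^+ 2 <= s / (256 * r).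
  rewrite /s mulr_suml; apply: ler_sum => e _.
  have -> : v e ^+ 2 / (256 * r) = r * (v e / (16 * r)) ^+ 2.
    by field; rewrite gt_eqF.
  by rewrite ler_wpM2r ?sqr_ge0.
have -> : - s / (128 * r) = - s / (64 * r) + 2 * (s / (256 * r)).
  by field; rewrite gt_eqF.
by rewrite lerD2l ler_pM2l.
Qed.

(* [K] bounds all the grid sizes [4 * m b], so that the indices of the grids
   live in a single type. *)
Lemma centred_gain_grid (R : realType) (E B : finType) (bl : E -> B)
    (th : E -> R) (r : R) (m : B -> nat) (N mean : B -> R) (K : nat) :
  0 < r -> (forall e, 0 <= th e <= 1) -> (forall e, th e <= r) ->
  (forall b, N b = #|[pred e | bl e == b]|%:R) ->
  (forall b, N b * mean b = \sum_(e | bl e == b) th e) ->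
  (forall b, 0 <= mean b <= r) ->
  (forall b, (4 * m b <= K)%N) ->
  (forall b, (0 < m b)%N) -> (forall b, r * N b <= (m b)%:R ^+ 2) ->
  (forall b, m b = 1%N \/ (m b)%:R ^+ 2 <= 4 * (r * N b)) ->
  let y b (j : 'I_K.+1) : R := ((j : nat)%:R - 2 * (m b)%:R) * (r / (m b)%:R) in
  let u (g : {ffun B -> 'I_K.+1}) e := mean (bl e) + y (bl e) (g (bl e)) - th e in
  exists Zs : {ffun E -> bool} -> R, [/\
    forall a, 0 <= Zs a,
    \sum_a bernoulli_weight th a * Zs a <= grid_const R ^+ #|B| &
    forall a (q : B -> R), (forall b, `|q b| <= r) ->
      exists2 G, centred_gain th a (fun e => q (bl e) - th e) <= G + #|B|%:R * (r / 8)
      & expR (G / (32 * r)) <= Zs a].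
Proof.
move=> r0 th01 thr NE meanE mean0r mK m0 mN m4 y u.
pose Q b (j : 'I_K.+1) := (j <= 4 * m b)%N.
(* Summing over all choices [g] of one grid point per block dominates the exponential gain at the
   best choice, which depends on the data. *)
exists (fun a => \sum_(g in family Q) expR (centred_gain th a (u g) / (32 * r))); split.
- by move=> a; apply: sumr_ge0 => g _; apply/ltW/expR_gt0.
- under eq_bigr do rewrite mulr_sumr.
  rewrite exchange_big /=.
  (* Pythagoras in each block: the deviations [mean b - th e] sum to 0, hence are orthogonal to the
     constant [y b (g b)]. *)
  have sqr_sum (g : {ffun B -> 'I_K.+1}) : \sum_e u g e ^+ 2 >= \sum_b N b * y b (g b) ^+ 2.
    rewrite (partition_big bl xpredT) //=; apply: ler_sum => b _.
    have e1 : \sum_(e | bl e == b) (mean b - th e) = 0.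
      rewrite sumrB sumr_const -meanE NE mulr_natl; exact: subrr.
    have -> : \sum_(e | bl e == b) u g e ^+ 2 =
      \sum_(e | bl e == b) (mean b - th e) ^+ 2 + N b * y b (g b) ^+ 2
      + 2 * y b (g b) * \sum_(e | bl e == b) (mean b - th e).
      rewrite NE mulr_natl -sumr_const mulr_sumr -!big_split /=.
      by apply: eq_bigr => e /eqP be; rewrite /u be; ring.
    rewrite e1 mulr0 addr0 lerDr; apply: sumr_ge0 => e _; exact: sqr_ge0.
  have ub (g : {ffun B -> 'I_K.+1}) e : g \in family Q -> u g e <= 8 * r.
    move=> /familyP /(_ (bl e)); rewrite unfold_in /Q => gm.
    have /andP[_ h1] := mean0r (bl e); have /andP[h2 _] := th01 e.
    suff : y (bl e) (g (bl e)) <= 2 * r by rewrite /u; lra.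
    have hm : 0 < (m (bl e))%:R :> R by rewrite ltr0n.
    rewrite /y mulrA ler_pdivrMr // mulrAC ler_wpM2r ?(ltW r0) //.
    move: gm; rewrite -(ler_nat R) natrM; lra.
  apply: (@le_trans _ _ (\sum_(g in family Q)
      \prod_b expR (- (N b * y b (g b) ^+ 2) / (128 * r)))).
    apply: ler_sum => g gQ; apply: le_trans.
      by apply: centred_gain_exp => // e; exact: ub.
    rewrite -expR_sum ler_expR -mulr_suml ler_wpM2r //.
      by rewrite invr_ge0 mulr_ge0 // ltW.
    by rewrite sumrN lerN2.
  (* Distributivity turns the sum over [g] into a product over the blocks of one-dimensional grid
     sums. *)
  rewrite -(bigA_distr_big_dep _ (fun b j => expR (- (N b * y b j ^+ 2) / (128 * r)))).
  rewrite -prodr_const; apply: ler_prod => b _; apply/andP; split.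
    by apply: sumr_ge0 => j _; apply/ltW/expR_gt0.
  have N0 : 0 <= r * N b by rewrite NE mulr_ge0 // ltW.
  apply: le_trans (grid_sum_le N0 (m0 b) (m4 b)).
  rewrite (big_ord_widen_cond K.+1 xpredT (fun j => expR
     (- ((j%:R - 2 * (m b)%:R) / (m b)%:R) ^+ 2 * (r * N b) / 128))) ?ltnS //.
  rewrite /Q; apply: ler_sum => j _; rewrite ler_expR le_eqVlt; apply/orP; left.
  have mb : (m b)%:R != 0 :> R by rewrite pnatr_eq0 -lt0n.
  have rn : r != 0 by rewrite gt_eqF.
  by apply/eqP; rewrite /y; field; rewrite ?mb ?rn.
move=> a q qr.
(* In one block the gain is a quadratic in the deviation from the mean, with leading coefficient
   [- N b / 2]; moving that deviation to a suitable grid point loses at most [r / 8]. *)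
have hq b : exists j : 'I_K.+1, (j <= 4 * m b)%N /\
    \sum_(e | bl e == b) (2 * ((a e)%:R - th e) * (q b - th e) - (q b - th e) ^+ 2 / 2)
    <= \sum_(e | bl e == b) (2 * ((a e)%:R - th e) * (mean b + y b j - th e) - (mean b
        + y b j - th e) ^+ 2 / 2) + r / 8.
  have qm : `|q b - mean b| <= 2 * r.
    by have := qr b; have := mean0r b; rewrite !ler_norml => /andP[? ?] /andP[? ?];
        apply/andP; split; lra.
  have N0 : 0 <= N b by rewrite NE.
  have [j jm hj] := quadratic_grid_bound
    (\sum_(e | bl e == b) 2 * ((a e)%:R - th e)) N0 r0 (m0 b) (mN b) qm.
  have jK : (j < K.+1)%N by rewrite ltnS (leq_trans jm).
  exists (Ordinal jK); split => //.
  pose f x := \sum_(e | bl e == b) (2 * ((a e)%:R - th e) * (mean b + x - th e) - (mean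
      b + x - th e) ^+ 2 / 2).
  have e1 : \sum_(e | bl e == b) (mean b - th e) = 0.
    rewrite sumrB sumr_const -meanE NE mulr_natl; exact: subrr.
  have fE x : f x = f 0 + ((\sum_(e | bl e == b) 2 * ((a e)%:R - th e)) * x
     - N b / 2 * x ^+ 2).
    have : f x = f 0 + ((\sum_(e | bl e == b) 2 * ((a e)%:R - th e)) * x
     - N b / 2 * x ^+ 2) - x * \sum_(e | bl e == b) (mean b - th e).
      rewrite /f NE mulr_suml -mulrA mulr_natl -sumr_const mulr_sumr -!sumrN -!big_split /=.
      by apply: eq_bigr => e _; field.
    by rewrite e1 mulr0 subr0.
  have -> : \sum_(e | bl e == b) (2 * ((a e)%:R - th e) * (q b - th e) - (q b - th e) ^+ 2 / 2)
    = f (q b - mean b).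
    by apply: eq_bigr => e _; rewrite (_ : mean b + (q b - mean b) = q b) //; ring.
  rewrite -/(f (y b (Ordinal jK))) fE [f (y _ _)]fE -addrA lerD2l; exact: hj.
have /fin_all_exists[g hg] := hq.
exists (centred_gain th a (u (finfun g))).
  rewrite /centred_gain (partition_big bl xpredT) //= [X in _ <= X + _](partition_big
      bl xpredT) //=.
  rewrite mulr_natl -sumr_const -big_split /=; apply: ler_sum => b _.
  have [_ h] := hg b.
  apply: le_trans (le_trans h _).
    by rewrite le_eqVlt; apply/orP; left; apply/eqP; apply: eq_bigr => e /eqP ->.
  rewrite lerD2r le_eqVlt; apply/orP; left; apply/eqP.
  by apply: eq_bigr => e /eqP be; rewrite /u ffunE be.
rewrite (bigD1 (finfun g)) /=; last first.
  by apply/familyP => b; rewrite ffunE; have [] := hg b.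
by rewrite lerDl; apply: sumr_ge0 => h _; apply/ltW/expR_gt0.
Qed.

(** Taking for [m b] the integer part of the square root of [r * N b], plus 1, meets both
    requirements on the grid: [m b ^ 2] is at least [r * N b], and at most [4 * r * N b] unless
    [m b = 1]. *)
Lemma block_gain_bound (R : realType) (E B : finType) (bl : E -> B)
    (th : E -> R) (r : R) :
  0 < r -> (forall e, 0 <= th e <= 1) -> (forall e, th e <= r) ->
  exists Zs : {ffun E -> bool} -> R, [/\
    forall a, 0 <= Zs a,
    \sum_a bernoulli_weight th a * Zs a <= grid_const R ^+ #|B| &
    forall a (q : B -> R), (forall b, `|q b| <= r) ->
      exists2 G, centred_gain th a (fun e => q (bl e) - th e) <= G + #|B|%:R * (r / 8)
      & expR (G / (32 * r)) <= Zs a].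
Proof.
move=> r0 th01 thr.
pose N b : R := #|[pred e | bl e == b]|%:R.
pose mean b := (\sum_(e | bl e == b) th e) / N b.
pose m b := (Num.truncn (Num.sqrt (r * N b))).+1.
have N0 b : 0 <= N b by rewrite ler0n.
have sN b : \sum_(e | bl e == b) th e <= N b * r.
  by rewrite mulr_natl -sumr_const; apply: ler_sum => e _.
have s0 b : 0 <= \sum_(e | bl e == b) th e.
  by apply: sumr_ge0 => e _; have /andP[] := th01 e.
apply: (@centred_gain_grid _ _ _ bl th r m N mean (\max_b (4 * m b))) => //.
(* For an empty block, division by 0 gives [mean b = 0] and both sides vanish. *)
- move=> b; rewrite /mean mulrC; have [/eqP Nb|Nb] := eqVneq (N b) 0.
    rewrite /N pnatr_eq0 in Nb; have /card0_eq h := eqP Nb.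
    rewrite /N (eqP Nb) mulr0 big_pred0 // => e; exact: (h e).
  by rewrite divfK.
- move=> b; apply/andP; split; first by rewrite divr_ge0.
  have [Nb|Nb] := eqVneq (N b) 0; first by rewrite /mean Nb invr0 mulr0 ltW.
  by rewrite /mean ler_pdivrMr ?[r * _]mulrC // lt_def Nb N0.
- by move=> b; apply: (leq_bigmax b).
- move=> b; rewrite -{1}(sqr_sqrtr (mulr_ge0 (ltW r0) (N0 b))).
  rewrite lerXn2r ?nnegrE ?sqrtr_ge0 ?ler0n //.
  by apply/ltW/truncnS_gt.
- move=> b; have [h|h] := leP 1 (r * N b).
    right; have h1 : 1 <= Num.sqrt (r * N b) by rewrite -sqrtr1 ler_wsqrtr.
    have h2 := truncn_le (Num.sqrt (r * N b)); rewrite sqrtr_ge0 in h2.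
    rewrite -(sqr_sqrtr (mulr_ge0 (ltW r0) (N0 b))).
    rewrite (_ : 4 * _ = (2 * Num.sqrt (r * N b)) ^+ 2); last by ring.
    rewrite lerXn2r ?nnegrE ?mulr_ge0 ?sqrtr_ge0 //.
    by rewrite /m -natr1; lra.
  left; congr S; apply/eqP; rewrite -leqn0 truncn_le_nat.
  by rewrite -sqrtr1 ltr_sqrt.
Qed.

(** The exponential moments of the block gains are summed over all [z], so the bound applies at the
    data-dependent [zh a]. Outside [good], entries in [[0, 1]] give a loss of at most 1 per edge. *)
Lemma oracle_inequality (R : realType) (E B Z : finType) (bl : Z -> E -> B)
    (th ths : E -> R) (r : R) (zh : {ffun E -> bool} -> Z)
    (qh : {ffun E -> bool} -> B -> R) (good : pred {ffun E -> bool}) :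
  0 < r -> (forall e, 0 <= th e <= 1) -> (forall e, th e <= r) ->
  (forall e, 0 <= ths e <= 1) ->
  (forall a : {ffun E -> bool}, \sum_e ((a e)%:R - qh a (bl (zh a) e)) ^+ 2 <=
             \sum_e ((a e)%:R - ths e) ^+ 2) ->
  (forall a, good a -> forall b, `|qh a b| <= r) ->
  (forall a, ~~ good a -> forall b, 0 <= qh a b <= 1) ->
  \sum_a bernoulli_weight th a * \sum_e (qh a (bl (zh a) e) - th e) ^+ 2 <=
  2 * \sum_e (ths e - th e) ^+ 2
  + r * (64 * (ln #|Z|%:R + #|B|%:R * ln (grid_const R) + 1) + #|B|%:R)
  + 5 * #|E|%:R * \sum_(a | ~~ good a) bernoulli_weight th a.
Proof.
move=> r0 th01 thr ths01 basic goodr bad01.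
have w0 a := bernoulli_weight_ge0 a th01.
have /fin_all_exists[Zs hZs] : forall z, exists Zs : {ffun E -> bool} -> R, [/\
    forall a, 0 <= Zs a,
    \sum_a bernoulli_weight th a * Zs a <= grid_const R ^+ #|B| &
    forall a (q : B -> R), (forall b, `|q b| <= r) ->
      exists2 G, centred_gain th a (fun e => q (bl z e) - th e) <= G + #|B|%:R * (r / 8)
      & expR (G / (32 * r)) <= Zs a].
  by move=> z; exact: block_gain_bound.
pose S a := \sum_z Zs z a.
pose c := ln #|Z|%:R + #|B|%:R * ln (grid_const R).
have Z1 : 1 <= #|Z|%:R :> R.
  by rewrite ler1n; apply/card_gt0P; exists (zh [ffun=> true]).
have g1 := grid_const_ge1 R; have g0 : 0 < grid_const R by lra.
have c0 : 0 <= c by rewrite addr_ge0 ?mulr_ge0 ?ln_ge0.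
have Z0 : 0 < #|Z|%:R :> R by lra.
have expc : expR c = #|Z|%:R * grid_const R ^+ #|B|.
  by rewrite expRD lnK ?posrE // expRM_natl lnK ?posrE.
have ES : \sum_a bernoulli_weight th a * (S a / expR c) <= 1.
  under eq_bigr do rewrite mulrA; rewrite -mulr_suml ler_pdivrMr ?expR_gt0 // mul1r expc.
  under eq_bigr do rewrite mulr_sumr; rewrite exchange_big /= mulr_natl -sumr_const.
  by apply: ler_sum => z _; have [] := hZs z.
have S0 a : 0 <= S a / expR c.
  by rewrite divr_ge0 ?(ltW (expR_gt0 _)) //; apply: sumr_ge0 => z _; have [] := hZs z.
pose D := \sum_e (ths e - th e) ^+ 2.
have D0 : 0 <= D by apply: sumr_ge0 => e _; exact: sqr_ge0.
pose V (a : {ffun E -> bool}) := \sum_e (- 2 * (ths e - th e)) * ((a e)%:R - th e).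
pose X a := \sum_e (qh a (bl (zh a) e) - th e) ^+ 2.
pose rem a := 32 * r * (c + S a / expR c) + #|B|%:R * (r / 8).
have rem0 a : 0 <= rem a.
  have h : 0 <= #|B|%:R :> R by rewrite ler0n.
  apply: addr_ge0; apply: mulr_ge0 => //; [lra|exact: addr_ge0|lra].
have card_sum (f : E -> R) (k : R) : (forall e, f e <= k) -> \sum_e f e <= k * #|E|%:R.
  by move=> h; rewrite mulr_natr -sumr_const; apply: ler_sum.
(* On bad data the loss is at most [#|E|] and [- 2 * V a] at most [4 * #|E|], whence the 5. The term
   [V a] is kept there because its mean vanishes only over all the data. *)
have main a : X a <= 2 * (D + V a + rem a) + 5 * #|E|%:R * (~~ good a)%:R.
  have [ga|ga] /= := boolP (good a); last first.
    have h1 : X a <= 1 * #|E|%:R.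
      apply: card_sum => e; rewrite expr2.
      have /andP[? ?] := bad01 a ga (bl (zh a) e); have /andP[? ?] := th01 e; nra.
    have h2 : - V a <= 2 * #|E|%:R.
      rewrite -sumrN; apply: card_sum => e.
      have /andP[? ?] := ths01 e; have /andP[? ?] := th01 e.
      by case: (a e) => /=; nra.
    by have := rem0 a; lra.
  rewrite mulr0 addr0.
  have h1 : X a <= D + V a + \sum_e 2 * ((a e)%:R - th e) * (qh a (bl (zh a) e) - th e).
    have := basic a; rewrite /X /D /V.
    have -> : \sum_e ((a e)%:R - qh a (bl (zh a) e)) ^+ 2 = X a +
       (\sum_e ((a e)%:R - th e) ^+ 2 -
         \sum_e 2 * ((a e)%:R - th e) * (qh a (bl (zh a) e) - th e)).
      by rewrite -sumrB -big_split; apply: eq_bigr => e _ /=; ring.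
    have -> : \sum_e ((a e)%:R - ths e) ^+ 2 = D + V a + \sum_e ((a e)%:R - th e) ^+ 2.
      by rewrite -!big_split; apply: eq_bigr => e _ /=; ring.
    rewrite -/(X a) -/D -/(V a); lra.
  have h2 : \sum_e 2 * ((a e)%:R - th e) * (qh a (bl (zh a) e) - th e) =
     centred_gain th a (fun e => qh a (bl (zh a) e) - th e) + X a / 2.
    by rewrite /X mulr_suml -big_split; apply: eq_bigr => e _ /=; ring.
  have [_ _ /(_ a (qh a) (goodr a ga))[G hG eG]] := hZs (zh a).
  have eS : expR (G / (32 * r)) <= S a.
    apply: (le_trans eG); rewrite /S (bigD1 (zh a)) //= lerDl.
    by apply: sumr_ge0 => z _; have [] := hZs z.
  (* [1 + x <= expR x] at [x = G / (32 * r) - c] bounds the gain by an affine function of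
     [S a / expR c], whose mean is at most 1. *)
  have hG' : G <= 32 * r * (c + S a / expR c).
    have h32 : 0 < 32 * r by rewrite mulr_gt0.
    rewrite mulrC -ler_pdivrMr //; set g := G / _ in eS *.
    have : 1 + (g - c) <= expR (g - c) by exact: expR_ge1Dx.
    have : expR (g - c) <= S a / expR c.
      by rewrite expRB ler_pM2r ?invr_gt0 ?expR_gt0.
    lra.
  by rewrite /rem; lra.
apply: (@le_trans _ _ (\sum_a bernoulli_weight th a *
   (2 * (D + V a + rem a) + 5 * #|E|%:R * (~~ good a)%:R))).
  by apply: ler_sum => a _; exact: ler_wpM2l (w0 a) _ _ (main a).
have lin (w f1 f2 f3 : {ffun E -> bool} -> R) k0 k1 k2 k3 :
    \sum_a w a * (k0 + k1 * f1 a + k2 * f2 a + k3 * f3 a) =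
    k0 * (\sum_a w a) + k1 * (\sum_a w a * f1 a) + k2 * (\sum_a w a * f2 a)
    + k3 * (\sum_a w a * f3 a).
  by rewrite !mulr_sumr -!big_split; apply: eq_bigr => a _ /=; ring.
rewrite (eq_bigr (fun a => bernoulli_weight th a *
   ((2 * D + 2 * #|B|%:R * (r / 8) + 64 * r * c) + 2 * V a + 64 * r * (S a / expR c)
    + 5 * #|E|%:R * (~~ good a)%:R))); last first.
  move=> a _; rewrite /rem; congr (_ * _).
  by move: (S a / expR c) (V a) => s v; ring.
rewrite lin.
rewrite bernoulli_weight_sum bernoulli_weight_noise_mean.
have -> : \sum_(a | ~~ good a) bernoulli_weight th a =
   \sum_a bernoulli_weight th a * (~~ good a)%:R.
  by rewrite big_mkcond; apply: eq_bigr => a _; case: (good a); rewrite /= ?mulr0 ?mulr1.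
rewrite lerD2r mulr0 addr0 mulr1 -/D -/c.
have := ler_wpM2l (ltW r0) ES.
have : 0 <= r * #|B|%:R by apply: mulr_ge0; [exact: ltW|rewrite ler0n].
move: (\sum_a _) => s; lra.
Qed.

(** * Edges and dense cuts *)

Lemma sum_pairs_edges (V : nmodType) (n : nat) (F : 'I_n -> 'I_n -> V) :
  \sum_i \sum_j F i j = \sum_i F i i +
  \sum_(e : edge n) (F (val e).1 (val e).2 + F (val e).2 (val e).1).
Proof.
rewrite pair_big /=.
rewrite (bigID (fun p : 'I_n * 'I_n => p.1 == p.2)) /=; congr (_ + _).
  rewrite -(pair_big_dep xpredT (fun i j => i == j) F) /=.
  by apply: eq_bigr => i _; rewrite (big_pred1 i) // => j; rewrite eq_sym.
rewrite (bigID (fun p : 'I_n * 'I_n => p.2 < p.1)%N) /= big_split /=.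
have sub (G : 'I_n * 'I_n -> V) :
    \sum_(p : 'I_n * 'I_n | (p.2 < p.1)%N) G p = \sum_(e : edge n) G (val e).
  rewrite (reindex_omap (val : edge n -> _) insub); last first.
    by move=> p hp; rewrite insubT.
  apply: eq_bigl => e; rewrite valK eqxx andbT; exact: (valP e).
congr (_ + _).
  rewrite -(sub (fun p => F p.1 p.2)); apply: eq_bigl => -[i j] /=.
  by rewrite -val_eqE; case: ltngtP.
rewrite -(sub (fun p => F p.2 p.1)).
rewrite (reindex_inj (h := fun p : 'I_n * 'I_n => (p.2, p.1))) /=; last first.
  by move=> [i j] [i' j'] [-> ->].
by apply: eq_bigl => -[i j] /=; rewrite -val_eqE; case: ltngtP.
Qed.

(** An edge lists its larger endpoint first, so both orders of the two sets are allowed. The sets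
    may overlap; they coincide for a diagonal block. *)
Definition cross (n : nat) (A B : {set 'I_n}) (e : edge n) : bool :=
  ((val e).1 \in A) && ((val e).2 \in B) || ((val e).1 \in B) && ((val e).2 \in A).

Lemma card_edge_le (n : nat) : (2 * #|{: edge n}| <= n ^ 2)%N.
Proof.
have := @sum_pairs_edges nat n (fun _ _ => 1%N).
rewrite !sum_nat_const !card_ord => h.
have {}h : (n * (n * 1) = n * 1 + #|{: edge n}| * 2)%N by exact: h.
by move: #|_| h => c h; nia.
Qed.

(** There are at least [#|A| * (#|B| - 1)] ordered pairs of distinct points, hence at least half the
    product, and an edge accounts for at most two of them. *)
Lemma card_cross_ge (n : nat) (A B : {set 'I_n}) :
  (2 <= #|A|)%N -> (2 <= #|B|)%N -> (#|A| * #|B| <= 4 * #|cross A B|)%N.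
Proof.
move=> A2 B2.
pose F i j : nat := [&& i \in A, j \in B & i != j].
have h1 : (\sum_i \sum_j F i j <= 2 * #|cross A B|)%N.
  have -> : (\sum_i \sum_j F i j = \sum_i F i i +
      \sum_(e : edge n) (F (val e).1 (val e).2 + F (val e).2 (val e).1))%N.
    exact: sum_pairs_edges.
  rewrite big1 ?add0n; last by move=> i _; rewrite /F eqxx !andbF.
  rewrite -sum1_card big_distrr [leqRHS]big_mkcond /=; apply: leq_sum => e _.
  rewrite /F -[e \in _]/(cross A B e) /cross /=; move: (sval e).1 (sval e).2 => u v.
  by case: (u != v); case: (v != u); case: (u \in A); case: (v \in B);
    case: (u \in B); case: (v \in A).
have h2 : (#|A| * (#|B| - 1) <= \sum_i \sum_j F i j)%N.
  rewrite -sum_nat_const [leqLHS]big_mkcond /=; apply: leq_sum => i _.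
  case: (boolP (i \in A)) => [iA|//].
  rewrite leq_subLR -sum1_card [leqLHS]big_mkcond /= [leqRHS]addnC.
  apply: (@leq_trans (\sum_j (F i j + (j == i)))%N).
    apply: leq_sum => j _; rewrite /F iA /= eq_sym.
    by case: (j \in B); case: (j == i).
  rewrite big_split /= leq_add2l.
  by rewrite (bigD1 i) //= eqxx big1 // => j /negPf ->.
nia.
Qed.

(** With the assignment fixed, the loss is a quadratic in one entry, minimal at the average of the
    data over the block. The product form also covers an empty block. *)
Lemma least_squares_block_mean (R : realType) (n k n0 : nat) (a : data n)
    (Qz : 'M[R]_k * {ffun 'I_n -> 'I_k}) (b c : 'I_k) :
  ls_minimizer (@sym_matrices R k) (assignments n k n0) a Qz ->
  let S := cross [set i | Qz.2 i == b]%SET [set i | Qz.2 i == c]%SET in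
  #|S|%:R * Qz.1 b c = \sum_(e | S e) (a e)%:R.
Proof.
case: Qz => Q z [].
rewrite /sym_matrices /= => symQ zZ minQ; set S := cross _ _.
have SE e : S e = ((z (val e).1 == b) && (z (val e).2 == c) ||
    (z (val e).1 == c) && (z (val e).2 == b)) by rewrite /S /cross !inE.
have Qs i j : Q i j = Q j i by rewrite -{1}[Q]symQ mxE.
pose f (q : R) := \sum_(e | S e) ((a e)%:R - q) ^+ 2.
have min_f q : f (Q b c) <= f q.
  (* The competitor changes the entry at [b, c] together with its mirror image, so as to stay
     symmetric. *)
  pose Q' : 'M[R]_k := \matrix_(i, j) (if (i == b) && (j == c) || (i == c) && (j == b)
    then q else Q i j).
  have sQ' : sym_matrices Q'.
    apply/matrixP => i j; rewrite !mxE Qs.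
    by rewrite orbC ![_ && (i == _)]andbC.
  have := minQ _ _ sQ' zZ.
  rewrite /ls_loss (bigID S) /= [leRHS](bigID S) /=.
  have -> : \sum_(e | ~~ S e) ((a e)%:R - Q' (z (val e).1) (z (val e).2)) ^+ 2 =
            \sum_(e | ~~ S e) ((a e)%:R - Q (z (val e).1) (z (val e).2)) ^+ 2.
    by apply: eq_bigr => e; rewrite SE mxE => /negPf ->.
  rewrite lerD2r.
  have -> : \sum_(e | S e) ((a e)%:R - Q' (z (val e).1) (z (val e).2)) ^+ 2 = f q.
    by apply: eq_bigr => e; rewrite SE mxE => ->.
  have -> // : \sum_(e | S e) ((a e)%:R - Q (z (val e).1) (z (val e).2)) ^+ 2 = f (Q b c).
  apply: eq_bigr => e; rewrite SE => /orP[] /andP[/eqP -> /eqP ->] //.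
  by rewrite Qs.
pose s : R := \sum_(e | S e) (a e)%:R.
pose N : R := #|S|%:R.
have fE q : f q = \sum_(e | S e) (a e)%:R ^+ 2 - 2 * q * s + N * q ^+ 2.
  have -> : N * q ^+ 2 = \sum_(e | S e) q ^+ 2.
    by rewrite /N mulr_natl -sumr_const; apply: eq_bigl.
  rewrite /f /s mulr_sumr -sumrB -big_split /=.
  by apply: eq_bigr => e _; ring.
have [N0|N0] := eqVneq N 0.
  rewrite -/N N0 mul0r big_pred0 // => e; apply/negbTE/negP => Se.
  by move/eqP: N0; rewrite pnatr_eq0 => /eqP/card0_eq/(_ e); rewrite -[e \in _]/(S e) Se.
have Np : 0 < N by rewrite lt_def N0 ler0n.
have := min_f (s / N); rewrite !fE -/N -/s.
set q := Q b c; set q' := s / N.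
have sE : s = N * q' by rewrite mulrC divfK.
rewrite sE => h.
have : N * (q - q') ^+ 2 <= 0 by nra.
rewrite pmulr_rle0 // => h2.
have /eqP : (q - q') ^+ 2 = 0 by apply/eqP; rewrite eq_le h2 sqr_ge0.
by rewrite expf_eq0 /= subr_eq0 => /eqP ->.
Qed.

(** Exponential Markov inequality with parameter 1/2 on [S]. With [N = #|S|] and [t] the sum of the
    means over [S], the exponent is [t - r * N / 2], where [t <= rho * N <= r * N / 4]. *)
Lemma bernoulli_weight_large_dev (R : realType) (E : finType) (th : E -> R)
    (S : pred E) (rho r : R) :
  (forall e, 0 <= th e <= 1) -> (forall e, th e <= rho) -> 4 * rho <= r ->
  \sum_(a : {ffun E -> bool} | r * #|S|%:R < \sum_(e | S e) (a e)%:R)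
    bernoulli_weight th a <= expR (- (r * #|S|%:R / 4)).
Proof.
move=> th01 thr rr.
pose v e : R := if S e then 1 / 2 else 0.
have v2 e : v e <= 1 / 2 by rewrite /v; case: (S e); lra.
have := bernoulli_weight_exp_noise th01 v2.
set N : R := #|S|%:R; set t := \sum_(e | S e) th e.
have vE (f : E -> R) : \sum_e v e * f e = (\sum_(e | S e) f e) / 2.
  rewrite [in RHS]big_mkcond mulr_suml; apply: eq_bigr => e _.
  by rewrite /v; case: (S e); lra.
have -> : 2 * \sum_e th e * v e ^+ 2 = t / 2.
  rewrite /t [in RHS]big_mkcond mulr_suml mulr_sumr; apply: eq_bigr => e _.
  by rewrite /v; case: (S e); lra.
move=> h.
have tN : t <= rho * N.
  have -> : rho * N = \sum_(e | S e) rho.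
    by rewrite /N mulr_natr -sumr_const; apply: eq_bigl.
  by apply: ler_sum => e _.
apply: (@le_trans _ _ (expR (t / 2 - r * N / 2) *
  (\sum_(a : {ffun E -> bool}) bernoulli_weight th a * expR (\sum_e v e * ((a e)%:R -
      th e))))).
  rewrite mulr_sumr big_mkcond; apply: ler_sum => a _.
  have w0 := bernoulli_weight_ge0 a th01.
  rewrite mulrCA -expRD; case: ifPn => [hS|_]; last by rewrite mulr_ge0 // ltW ?expR_gt0.
  rewrite -[leLHS]mulr1 ler_wpM2l // -[leLHS](@expR0 R) ler_expR vE sumrB -/t.
  by lra.
apply: le_trans (ler_wpM2l (ltW (expR_gt0 _)) h) _.
rewrite -expRD ler_expR.
have N0 : 0 <= N by rewrite ler0n.
have : 4 * rho * N <= r * N by rewrite ler_wpM2r.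
lra.
Qed.

(* Chernoff: [expR (s * (#|A| - n0)) >= 1] on the sets under consideration. *)
Lemma sum_subsets_exp_le (R : realType) (n n0 : nat) (s t : R) :
  0 <= s ->
  \sum_(A : {set 'I_n} | (n0 <= #|A|)%N) expR (- t * #|A|%:R) <=
  expR (- s * n0%:R) * (1 + expR (s - t)) ^+ n.
Proof.
move=> s0.
have -> : (1 + expR (s - t)) ^+ n = \sum_(A : {set 'I_n}) expR (s - t) ^+ #|A|.
  rewrite -[in LHS](card_ord n) -prodr_const addrC (bigA_distr _ _ (fun=> expR (s - t))
      (fun=> 1)).
  apply: eq_bigr => A _; rewrite -big_mkcond /= prodr_const.
  by congr (_ ^+ _).
rewrite mulr_sumr big_mkcond /=; apply: ler_sum => A _.
have e0 : 0 <= expR (- s * n0%:R) * expR (s - t) ^+ #|A|.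
  by rewrite mulr_ge0 ?exprn_ge0 // ltW ?expR_gt0.
case: ifPn => // hA; rewrite -expRM_natl -expRD ler_expR.
have : n0%:R <= #|A|%:R :> R by rewrite ler_nat.
by nra.
Qed.

(** Quantifying over all pairs of large sets makes this a property of the data alone, which can be
    applied to the fibers of a data-dependent assignment. *)
Definition no_dense_cut (R : realType) (n n0 : nat) (r : R) (a : data n) : bool :=
  [forall A : {set 'I_n}, forall B : {set 'I_n},
    (n0 <= #|A|)%N && (n0 <= #|B|)%N ==>
    (\sum_(e | cross A B e) (a e)%:R <= r * #|cross A B|%:R)].

(* The choice of [s] makes [1 + expR (s - t) = 1 + 1 / k.+1], whose [n]-th power
   is at most [expR n0]. *)
Lemma dense_cut_weight (R : realType) (n n0 k : nat) (th : edge n -> R) (rho r : R) :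
  (forall e, 0 <= th e <= 1) -> (forall e, th e <= rho) -> 4 * rho <= r ->
  0 <= rho -> (2 <= n0)%N -> (n <= k.+1 * n0)%N ->
  let s := r * n0%:R / 32 - ln k.+1%:R in 0 <= s ->
  \sum_(a : data n | ~~ no_dense_cut n0 r a) bernoulli_weight th a <=
  expR (2 * n0%:R * (1 - s)).
Proof.
move=> th01 thr rr rho0 n02 nk s s0.
pose t := r * n0%:R / 32.
have w0 a := bernoulli_weight_ge0 a th01.
pose ok (A : {set 'I_n}) := (n0 <= #|A|)%N.
pose bad A B (a : data n) := r * #|cross A B|%:R < \sum_(e | cross A B e) (a e)%:R.
apply: (@le_trans _ _ (\sum_(A | ok A) \sum_(B | ok B)
   \sum_(a | bad A B a) bernoulli_weight th a)).
  rewrite pair_big_dep /= (exchange_big_dep xpredT) //=.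
  rewrite big_mkcond /=; apply: ler_sum => a _; case: ifPn => [|_]; last exact: sumr_ge0.
  rewrite negb_forall => /existsP[A]; rewrite negb_forall => /existsP[B].
  rewrite negb_imply -ltNge => /andP[/andP[hA hB] hAB].
  rewrite (bigD1 (A, B)) /=; first by rewrite lerDl sumr_ge0.
  by rewrite /ok hA hB.
apply: (@le_trans _ _ (\sum_(A | ok A) \sum_(B | ok B)
   expR (- t * #|A|%:R) * expR (- t * #|B|%:R))).
  apply: ler_sum => A hA; apply: ler_sum => B hB.
  apply: le_trans (bernoulli_weight_large_dev (cross A B) th01 thr rr) _.
  rewrite -expRD ler_expR /t.
  have h := card_cross_ge (leq_trans n02 hA) (leq_trans n02 hB).
  (* As both sets have at least [n0] points, [n0 * (#|A| + #|B|) <= 2 * #|A| * #|B|]. The exponent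
     becomes additive in the two sizes, and the union bound over pairs becomes the square of a sum
     over single sets. *)
  have h1 : n0%:R * (#|A|%:R + #|B|%:R) <= 8 * #|cross A B|%:R :> R.
    rewrite -natrD -!natrM ler_nat; move: hA hB; rewrite /ok => hA hB; nia.
  have r0 : 0 <= r by lra.
  have := ler_wpM2l r0 h1; lra.
under eq_bigr do rewrite -mulr_sumr.
rewrite -mulr_suml -expr2.
have h := sum_subsets_exp_le n n0 t s0.
have h2 : expR (- s * n0%:R) * (1 + expR (s - t)) ^+ n <= expR (n0%:R * (1 - s)).
  have -> : n0%:R * (1 - s) = - s * n0%:R + n0%:R by ring.
  rewrite [leRHS]expRD ler_wpM2l ?(ltW (expR_gt0 _)) //.
  have -> : s - t = - ln k.+1%:R by rewrite /s -/t; ring.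
  rewrite expRN lnK ?posrE ?ltr0n //.
  apply: (@le_trans _ _ (expR (k.+1%:R^-1) ^+ n)).
    by rewrite lerXn2r ?nnegrE ?addr_ge0 ?invr_ge0 ?(ltW (expR_gt0 _)) // expR_ge1Dx.
  rewrite -expRM_natl ler_expR ler_pdivrMr ?ltr0n //.
  by rewrite -natrM ler_nat mulnC.
have -> : 2 * n0%:R * (1 - s) = n0%:R * (1 - s) + n0%:R * (1 - s) by ring.
rewrite expRD -expr2 lerXn2r ?nnegrE ?(ltW (expR_gt0 _)) //.
  by apply: sumr_ge0 => A _; rewrite ltW ?expR_gt0.
exact: le_trans h h2.
Qed.

(** * Assignments adapted to the latent points *)

(** Among the refinements of [f], one with the largest image is onto. If a label [b] were missed,
    the image would have fewer than [k <= n] elements, two points would share a label, and moving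
    one of them to [b] would enlarge the image. *)
Lemma exists_surjective_refinement (n k : nat) (f : 'I_n -> 'I_k) :
  (k <= n)%N -> exists2 z : {ffun 'I_n -> 'I_k}, (forall b, exists i, z i = b) &
    forall i j, z i = z j -> f i = f j.
Proof.
move=> kn.
pose ok (z : {ffun 'I_n -> 'I_k}) := [forall i, forall j, (z i == z j) ==> (f i == f j)].
have ok0 : ok (finfun f).
  by apply/forallP => i; apply/forallP => j; rewrite !ffunE; apply/implyP.
case: (@arg_maxnP _ (finfun f) ok (fun z => #|z @: [set: 'I_n]|%SET)) => // z zok zmax.
exists z; last first.
  by move=> i j zij; move/forallP/(_ i)/forallP/(_ j): zok; rewrite zij eqxx => /eqP.
move=> b; case: (boolP [exists i, z i == b]) => [/existsP[i /eqP]|hb]; first by exists i.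
have nb : b \notin (z @: [set: 'I_n])%SET.
  apply/imsetP => -[i _ bi]; move/negP: hb; apply; apply/existsP; exists i; exact/eqP.
have lt_im : (#|(z @: [set: 'I_n])%SET| < #|[set: 'I_n]%SET|)%N.
  rewrite cardsT card_ord; apply: leq_trans kn.
  rewrite -[ltnRHS](card_ord k) -cardsT; apply: proper_card.
  by rewrite properT; apply/eqP => h; rewrite h inE in nb.
have /injectivePn[i [j ij zij]] : ~~ injectiveb z.
  apply/negP => /injectiveP inj; move: lt_im.
  by rewrite card_imset // ltnn.
pose z' := [ffun l => if l == i then b else z l].
have bz l : z l != b by apply: contra hb => h; apply/existsP; exists l.
have z'ok : ok z'.
  apply/forallP => l; apply/forallP => m; rewrite !ffunE; apply/implyP.
  case: (eqVneq l i) => [->|_]; case: (eqVneq m i) => [->|_] //.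
  - by move=> /eqP h; have := bz m; rewrite -h eqxx.
  - by move=> /eqP h; have := bz l; rewrite h eqxx.
  - by move=> h; move/forallP/(_ l)/forallP/(_ m): zok; rewrite h.
have mem_z' l : z' l \in (z' @: [set: 'I_n])%SET by apply: imset_f; rewrite inE.
have := zmax _ z'ok; rewrite /geq /= leqNgt => /negP[].
apply: (@leq_trans #|(b |: (z @: [set: 'I_n]))%SET|); first by rewrite cardsU1 nb.
apply/subset_leq_card/fintype.subsetP => c; rewrite in_setU1 => /orP[/eqP ->|/imsetP[l _ ->]].
  by have := mem_z' i; rewrite {1}/z' ffunE eqxx.
case: (eqVneq l i) => [->|li].
  by have := mem_z' j; rewrite {1}/z' ffunE eq_sym (negPf ij) zij.
by have := mem_z' l; rewrite {1}/z' ffunE (negPf li).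
Qed.

Lemma exists_rank (R : realType) (n : nat) (x : 'I_n -> R) :
  exists2 s : 'I_n -> 'I_n, injective s & forall i j, x i < x j -> (s i < s j)%N.
Proof.
pose le : rel 'I_n := fun i j => x i <= x j.
pose s := sort le (enum 'I_n).
have ss : size s = n by rewrite size_sort size_enum_ord.
have ins i : i \in s by rewrite mem_sort mem_enum.
have idx i : (index i s < n)%N by rewrite -{2}ss index_mem.
exists (fun i => Ordinal (idx i)).
  move=> i j /(congr1 val) /= h.
  by rewrite -(nth_index i (ins i)) h nth_index.
move=> i j xij /=; rewrite ltnNge; apply/negP => h.
have tot : total le by move=> a b; exact: le_total.
have tr : transitive le by move=> a b c; exact: le_trans.
have rf : reflexive le by move=> a; exact: lexx.
have := sorted_leq_index tr rf (sort_sorted tot (enum 'I_n)) _ _ (ins j) (ins i) h.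
by rewrite /le leNgt xij.
Qed.

Lemma card_ord_between (n a b : nat) :
  (#|[set m : 'I_n | (a < m)%N && (m < b)%N]%SET| <= b - a.+1)%N.
Proof.
rewrite cardE -(size_map val) -[leqRHS](size_iota a.+1).
apply: uniq_leq_size; first by rewrite map_inj_uniq ?enum_uniq //; exact: val_inj.
move=> m /mapP[i]; rewrite mem_enum inE => /andP[h1 h2] ->.
by rewrite mem_iota h1 /=; lia.
Qed.

Lemma exists_consecutive_assignment (R : realType) (n k n0 : nat) (x : 'I_n -> R) :
  (0 < k)%N -> (0 < n0)%N -> k = (n %/ n0)%N ->
  exists2 z, z \in assignments n k n0 &
    forall i j, z i = z j -> x i < x j ->
      (#|[set l | (x i < x l)%R && (x l < x j)%R]%SET| < 2 * n0)%N.
Proof.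
move=> k0 n00 kE; have [s sinj smono] := exists_rank x.
have kn : (k * n0 <= n)%N by rewrite kE leq_divM.
have nk : (n < k.+1 * n0)%N by rewrite kE ltn_ceil.
(* Classes are runs of [n0] consecutive ranks. The minimum with [k.-1] sends the [n %% n0] remaining
   points to the last class, which thus has fewer than [2 * n0] points. *)
have zlt i : (minn (s i %/ n0) k.-1 < k)%N by rewrite (leq_ltn_trans (geq_minr _ _)) // prednK.
exists [ffun i => Ordinal (zlt i)].
  rewrite inE; apply/forallP => b.
  have clt (c : 'I_n0) : (b * n0 + c < n)%N.
    apply: leq_trans kn; rewrite (@leq_trans (b.+1 * n0)) ?leq_mul2r ?ltn_ord ?orbT //.
    by rewrite mulSn addnC ltn_add2r.
  pose g (c : 'I_n0) := invF sinj (Ordinal (clt c)).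
  have ginj : injective g.
    move=> c d /(congr1 s); rewrite !f_invF => /(congr1 val) /= /eqP.
    by rewrite eqn_add2l => /eqP/val_inj.
  rewrite -[leqLHS](card_ord n0) -cardsT -(card_imset _ ginj).
  apply/subset_leq_card/fintype.subsetP => i /imsetP[c _ ->].
  rewrite inE ffunE -val_eqE /= f_invF /=.
  by rewrite divnMDl // divn_small // addn0; apply/eqP/minn_idPl; rewrite -ltnS prednK.
move=> i j; rewrite !ffunE => /(congr1 val) /= zij xij.
have sij := smono _ _ xij.
have lt2 : (s j < s i + 2 * n0)%N.
  have h1 := leq_divM (s i) n0; have h2 := ltn_ceil (s j) n00.
  have h3 := leq_trans (ltn_ord (s j)) (ltnW nk).
  have [h|h] := leqP (s j %/ n0)%N k.-1.
    have : (s j %/ n0 <= s i %/ n0)%N by lia.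
    nia.
  have : (k.-1 <= s i %/ n0)%N by lia.
  nia.
rewrite -(card_imset _ sinj); apply: (@leq_ltn_trans (s j - (s i).+1)); last by lia.
apply: leq_trans (card_ord_between n (s i) (s j)).
apply/subset_leq_card/fintype.subsetP => m /imsetP[l]; rewrite !inE => /andP[h1 h2] ->.
by rewrite !smono.
Qed.

Definition bin_count (R : realType) (n K : nat) (x : 'I_n -> R) (t : 'I_K) : nat :=
  #|[set l | (t%:R / K%:R <= x l)%R && (x l < t.+1%:R / K%:R)%R]%SET|.

(** At a distance larger than [2 / K], the bin following the one of [x i] would lie strictly between
    [x i] and [x j], with its [m] points. *)
Lemma diameter_of_full_bins (R : realType) (n K m : nat) (x : 'I_n -> R) i j :
  (0 < K)%N -> (forall l, 0 <= x l <= 1) ->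
  (forall t : 'I_K, (m <= bin_count x t)%N) ->
  (#|[set l | (x i < x l)%R && (x l < x j)%R]%SET| < m)%N ->
  x j - x i <= 2 / K%:R.
Proof.
move=> K0 x01 full few; rewrite leNgt; apply/negP => far.
have K0' : 0 < K%:R :> R by rewrite ltr0n.
have /andP[xi0 _] := x01 i; have /andP[_ xj1] := x01 j.
have h0 : 0 <= x i * K%:R by rewrite mulr_ge0 // ltW.
have /andP[t1 t2] := truncn_itv h0.
set t := Num.truncn _ in t1 t2.
have far' : 2 < (x j - x i) * K%:R by rewrite -ltr_pdivrMr.
have tK : (t.+1 < K)%N.
  rewrite -(ltr_nat R) -natr1; nra.
have := full (Ordinal tK); rewrite leqNgt => /negP[]; apply: leq_ltn_trans few.
apply/subset_leq_card/fintype.subsetP => l; rewrite !inE /= => /andP[h1 h2].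
apply/andP; split.
  by apply: lt_le_trans h1; rewrite ltr_pdivlMr.
apply: (lt_trans h2); rewrite ltr_pdivrMr // -[t.+2%:R]natr1 -natr1; nra.
Qed.

(** The entries of [Q] are the values of [rho * W] at one representative of each class. Replacing a
    point by its representative costs [M] times the power of [eps] in each of the two
    coordinates. *)
Lemma exists_block_approximation (R : realType) (n k : nat) (W : R * R -> R)
    (M a eps rho : R) (x : 'I_n -> R) (z : {ffun 'I_n -> 'I_k}) :
  graphon W ->
  (forall x y x' y', x \in `[0, 1] -> y \in `[0, 1] -> x' \in `[0, 1] -> y' \in `[0, 1] ->
    `|W (x', y') - W (x, y)| <= M * (`|x' - x| `^ a + `|y' - y| `^ a)) ->
  0 <= M -> 0 <= a -> 0 <= rho -> (forall i, x i \in `[0, 1]) ->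
  (forall b, exists i, z i = b) ->
  (forall i j, z i = z j -> `|x i - x j| <= eps) ->
  exists2 Q : 'M[R]_k, sym_matrices Q /\ (forall b c, 0 <= Q b c <= rho) &
    forall i j, (Q (z i) (z j) - rho * W (x i, x j)) ^+ 2 <=
      rho ^+ 2 * (4 * M ^+ 2 * (eps `^ a) ^+ 2).
Proof.
move=> gW lipW M0 a0 rho0 x01 /fin_all_exists[c cz] zeps.
exists (\matrix_(b, b') (rho * W (x (c b), x (c b')))); first split.
- by apply/matrixP => b b'; rewrite !mxE (graphon_sym gW).
- move=> b b'; rewrite mxE; have := graphon_unit gW (x01 (c b)) (x01 (c b')).
  by rewrite in_itv /= => /andP[h1 h2]; apply/andP; split; [exact: mulr_ge0|nra].
move=> i j; rewrite mxE -mulrBr exprMn ler_wpM2l ?sqr_ge0 //.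
have -> : 4 * M ^+ 2 * (eps `^ a) ^+ 2 = (2 * M * eps `^ a) ^+ 2 by ring.
have E0 : 0 <= 2 * M * eps `^ a by rewrite !mulr_ge0 // powR_ge0.
rewrite -[leLHS]real_normK ?num_real // lerXn2r ?nnegrE //.
apply: le_trans (lipW _ _ _ _ (x01 i) (x01 j) (x01 _) (x01 _)) _.
have pw u v : z u = z v -> `|x u - x v| `^ a <= eps `^ a.
  move=> uv; have h := zeps _ _ uv.
  by rewrite ge0_ler_powR ?nnegrE // (le_trans _ h).
have h1 := pw (c (z i)) i (cz _); have h2 := pw (c (z j)) j (cz _).
by nra.
Qed.

(** * Hoelder graphons are Lipschitz *)

Lemma is_derive01_eps (R : realType) (f : R -> R) (x l eps : R) :
  is_derive01 f x l -> 0 < eps ->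
  exists2 d, 0 < d & forall t, t \in `[0, 1] -> `|t - x| < d ->
    `|f t - f x| <= (`|l| + eps) * `|t - x|.
Proof.
move=> /cvgrPdist_le h e0; have := h _ e0.
rewrite near_withinE near_withinE => /nbhs_ballP[d /= d0 hd].
exists d => // t t01 td; have [->|tx] := eqVneq t x; first by rewrite !subrr normr0 mulr0.
have /= := hd t; rewrite /ball /= distrC => /(_ td tx t01) {}hd.
have tx0 : t - x != 0 by rewrite subr_eq0.
have -> : f t - f x = ((f t - f x) / (t - x)) * (t - x) by rewrite divfK.
rewrite normrM ler_wpM2r //.
move: hd; set q := _ / _ => hd.
have := ler_normD l (q - l); rewrite addrC subrK [`|q - l|]distrC; lra.
Qed.

(** Continuity induction: the points satisfying the bound with the slightly larger slope [B + e']
    have a supremum, which satisfies it too and cannot be smaller than [v]. Only the local estimate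
    relative to [[0, 1]] is used, so endpoints are treated like other points. *)
Lemma derive01_lipschitz (R : realType) (f g : R -> R) (B : R) :
  (forall x, x \in `[0, 1] -> is_derive01 f x (g x)) ->
  (forall x, x \in `[0, 1] -> `|g x| <= B) ->
  forall u v, u \in `[0, 1] -> v \in `[0, 1] -> `|f v - f u| <= B * `|v - u|.
Proof.
move=> df gB.
suff incr u v : u \in `[0, 1] -> v \in `[0, 1] -> u <= v -> `|f v - f u| <= B * (v - u).
  move=> u v hu hv; have [uv|/ltW vu] := leP u v.
    by rewrite (ger0_norm (_ : 0 <= v - u)) ?subr_ge0 //; exact: incr.
  rewrite distrC [`|v - u|]distrC (ger0_norm (_ : 0 <= u - v)) ?subr_ge0 //.
  exact: incr.
rewrite !in_itv /= => /andP[u0 u1] /andP[v0 v1] uv.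
apply/ler_addgt0Pr => e e0; set e' := e / 2.
have e'0 : 0 < e' by rewrite /e'; lra.
pose S : set R := [set s | u <= s <= v /\ `|f s - f u| <= (B + e') * (s - u)].
have Su : S u by rewrite /S /= lexx uv !subrr normr0 mulr0.
have hs : has_sup S by split; [exists u|exists v => s [/andP[]]].
pose m := sup S.
have um : u <= m by exact: (ub_le_sup (proj2 hs)).
have mv : m <= v by apply: (ge_sup (proj1 hs)) => s [/andP[]].
have m01 : m \in `[0, 1] by rewrite in_itv /=; apply/andP; split; lra.
have B0 : 0 <= B by exact: le_trans (normr_ge0 _) (gB _ m01).
have [d d0 hd] := is_derive01_eps (df _ m01) e'0.
have {}hd t : t \in `[0, 1] -> `|t - m| < d -> `|f t - f m| <= (B + e') * `|t - m|.
  move=> h1 h2; apply: le_trans (hd t h1 h2) _.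
  by rewrite ler_wpM2r // lerD2r gB.
have Sm : S m.
  have [s Ss ms] := sup_adherent d0 hs; have [/andP[us sv] hS] := Ss.
  have sm : s <= m by exact: (ub_le_sup (proj2 hs)).
  split; first by rewrite um mv.
  have s01 : s \in `[0, 1] by rewrite in_itv /=; apply/andP; split; lra.
  have smd : `|s - m| < d by rewrite distrC ger0_norm -/m ?subr_ge0 //; rewrite -/m in ms; lra.
  have := hd s s01 smd; rewrite distrC [`|s - m|]distrC (ger0_norm (_ : 0 <= m - s))
      ?subr_ge0 // => h1.
  have := ler_normD (f m - f s) (f s - f u); rewrite addrA subrK; lra.
have [vm|vm] := leP v m.
  have <- : m = v by apply/eqP; rewrite eq_le mv vm.
  have [_ h] := Sm; apply: (le_trans h).
  have : m - u <= 2 by lra.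
  rewrite /e'; nra.
(* If [m < v], the local estimate at [m] extends the bound to this [t > m], against the choice of
   [m]. *)
pose t := Num.min v (m + d / 2).
have tm : m < t by rewrite lt_min vm /=; lra.
have tv : t <= v by rewrite ge_min lexx.
have td : t <= m + d / 2 by rewrite ge_min lexx orbT.
have t01 : t \in `[0, 1] by rewrite in_itv /=; apply/andP; split; lra.
have tmd : `|t - m| < d by rewrite ger0_norm; lra.
have St : S t.
  split; first by apply/andP; split; lra.
  have := hd t t01 tmd; rewrite (ger0_norm (_ : 0 <= t - m)); last by lra.
  have [_ h] := Sm.
  have := ler_normD (f t - f m) (f m - f u); rewrite addrA subrK; lra.
have : t <= m by exact: (ub_le_sup (proj2 hs)).
by rewrite leNgt tm.
Qed.

(** A Markov-type inequality, with a constant that depends on the degree only. The interval has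
    length 1/2 because every point of [[0, 1]] has that much room on at least one side. *)
Lemma linear_coef_bound (R : realType) (l : nat) : exists2 C : R, 0 <= C &
  forall (c : nat -> R) (B : R),
    (forall h : R, 0 <= h <= 1 / 2 -> `|\sum_(i < l.+2) c i * h ^+ i| <= B) ->
    `|c 1%N| <= C * B.
Proof.
elim: l => [|l [C C0 IH]].
  exists 4 => // c B hc.
  have h0 := hc 0; have h1 := hc (1 / 2).
  rewrite !big_ord_recl !big_ord0 /= /bump /= !expr0 !expr1 !mulr1 !addr0 in h0 h1.
  have {}h0 : `|c 0%N + c (1 + 0)%N * 0| <= B by apply: h0; apply/andP; split; lra.
  have {}h1 : `|c 0%N + c (1 + 0)%N * (1 / 2)| <= B by apply: h1; apply/andP; split; lra.
  rewrite mulr0 addr0 in h0; rewrite addn0 in h1; move: h0 h1; rewrite !ler_norml =>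
      /andP[? ?] /andP[? ?].
  by apply/andP; split; lra.
exists (C * (1 + 2 ^+ l.+2)); first by rewrite mulr_ge0 // addr_ge0 // exprn_ge0.
move=> c B hc.
(* [p h - 2 ^ d * p (h / 2)] has no term of degree [d = l + 2]. *)
pose c' i : R := c i * (1 - 2 ^+ l.+2 / 2 ^+ i).
have h' (h : R) : 0 <= h <= 1 / 2 -> `|\sum_(i < l.+2) c' i * h ^+ i| <= (1 + 2 ^+ l.+2) * B.
  move=> /andP[h0 h1].
  have -> : \sum_(i < l.+2) c' i * h ^+ i = \sum_(i < l.+3) c i * h ^+ i
     - 2 ^+ l.+2 * \sum_(i < l.+3) c i * (h / 2) ^+ i.
    rewrite mulr_sumr -sumrB [RHS]big_ord_recr /= exprMn exprVn.
    have -> : c l.+2 * h ^+ l.+2 - 2 ^+ l.+2 * (c l.+2 * (h ^+ l.+2 / 2 ^+ l.+2)) = 0.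
      by field; rewrite expf_neq0.
    rewrite addr0; apply: eq_bigr => i _; rewrite /c' exprMn exprVn; ring.
  have hh1 : 0 <= h <= 1 / 2 by apply/andP; split; lra.
  have hh2 : 0 <= h / 2 <= 1 / 2 by apply/andP; split; lra.
  have p1 := hc _ hh1; have p2 := hc _ hh2.
  apply: le_trans (ler_normB _ _) _; rewrite mulrDl mul1r; apply: lerD => //.
  by rewrite normrM ger0_norm ?exprn_ge0 // ler_wpM2l // exprn_ge0.
have := IH c' _ h'; rewrite mulrA; apply: le_trans.
(* The coefficient [c 1] is multiplied by [1 - 2 ^ (l + 1)], of absolute value at least 1. *)
rewrite /c' normrM -[leLHS]mulr1 ler_wpM2l //.
rewrite exprS expr1 mulrAC divff // mul1r -normrN opprB ger0_norm.
  have : 1 <= 2 ^+ l :> R by rewrite exprn_ege1 // ler1n.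
  by rewrite exprS; lra.
by rewrite subr_ge0 exprn_ege1 // ler1n.
Qed.

Lemma taylor_poly_horizontal (R : realType) l (D : nat -> nat -> R * R -> R) p (h : R) :
  taylor_poly l D p (h, 0) = \sum_(i < l.+1) D i 0%N p / (i`!)%:R * h ^+ i.
Proof.
apply: eq_bigr => i _; rewrite (bigD1 ord0) /=; last by rewrite addn0 -ltnS.
rewrite big1 ?addr0 ?mulr1 ?expr0 ?muln1 ?mulr1 // => j /andP[_ j0].
by rewrite expr0n -[_ == _ :> nat]/(j == ord0) (negPf j0) mulr0.
Qed.

Lemma taylor_poly_vertical (R : realType) l (D : nat -> nat -> R * R -> R) p (h : R) :
  taylor_poly l D p (0, h) = \sum_(i < l.+1) D 0%N i p / (i`!)%:R * h ^+ i.
Proof.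
rewrite /taylor_poly (bigD1 ord0) //= [X in _ + X]big1 ?addr0; last first.
  move=> i i0; apply: big1 => j _.
  by rewrite expr0n -[_ == _ :> nat]/(i == ord0) (negPf i0) mulr0 mul0r.
apply: eq_big => [j|j _]; first by rewrite add0n -ltnS ltn_ord.
by rewrite expr0 mulr1 mul1n.
Qed.

(** On an interval of length 1/2 starting at [x], in the direction [s] that stays in [[0, 1]], the
    polynomial is within [L] of a function with values in [[0, 1]], hence bounded by [1 + L]. *)
Lemma taylor_linear_coef_bound (R : realType) (l : nat) : exists2 C : R, 0 <= C &
  forall (f : R -> R) (c : nat -> R) (b L x : R), 0 <= L -> 0 < b -> x \in `[0, 1] ->
    (forall t, t \in `[0, 1] -> f t \in `[0, 1]) ->
    (forall t, t \in `[0, 1] ->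
      `|f t - \sum_(i < l.+2) c i * (t - x) ^+ i| <= L * `|t - x| `^ b) ->
    `|c 1%N| <= C * (1 + L).
Proof.
have [C C0 hC] := linear_coef_bound R l; exists C => // f c b L x L0 b0.
rewrite in_itv /= => /andP[x0 x1] f01 hf.
have aux s : (s = 1 \/ s = -1) -> (forall h : R, 0 <= h <= 1 / 2 -> 0 <= x + s * h <= 1) ->
    `|c 1%N| <= C * (1 + L).
  move=> s1 hs; have -> : `|c 1%N| = `|c 1%N * s ^+ 1|.
    by rewrite normrM; case: s1 => ->; rewrite expr1 ?normrN normr1 mulr1.
  apply: (hC (fun i => c i * s ^+ i)) => h hh.
  have xs := hs h hh; have := hf (x + s * h); rewrite in_itv /= xs => /(_ isT).
  have := f01 (x + s * h); rewrite !in_itv /= xs => /(_ isT) /andP[f0 f1].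
  rewrite [x + _]addrC addrK.
  have -> : \sum_(i < l.+2) c i * (s * h) ^+ i = \sum_(i < l.+2) c i * s ^+ i * h ^+ i.
    by apply: eq_bigr => i _; rewrite exprMn mulrA.
  set p := \sum_(i < _) _.
  have -> : `|s * h| = h.
    move/andP: hh => [h0 _]; rewrite normrM (ger0_norm h0).
    by case: s1 => ->; rewrite ?normrN normr1 mul1r.
  have hb : h `^ b <= 1.
    have /andP[h0 h1] := hh.
    have e1 : (1 : R) `^ b = 1 by rewrite powR1.
    rewrite -[leRHS]e1 ge0_ler_powR ?nnegrE //; lra.
  have : L * h `^ b <= L by rewrite -[leRHS]mulr1 ler_wpM2l.
  move: f0 f1; rewrite [s * h + x]addrC; set y := f _ => f0 f1.
  rewrite !ler_norml => h1 /andP[h2 h3]; apply/andP; split; lra.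
have [xh|xh] := leP x (1 / 2).
  by apply: (aux 1); [left|move=> h /andP[h0 h1]; apply/andP; split; lra].
by apply: (aux (-1)); [right|move=> h /andP[h0 h1]; apply/andP; split; lra].
Qed.

(** For [alpha <= 1] the Taylor polynomial is constant and the class is defined by the claim itself.
    For [alpha > 1] the first partial derivatives are bounded through the Taylor polynomials on
    horizontal and vertical lines, and the increment is split into a vertical and a horizontal
    one. *)
Lemma holder_class_lipschitz (R : realType) (alpha L : R) : 0 < alpha -> 0 < L ->
  exists2 M : R, 0 <= M & forall W, holder_class alpha L W ->
    forall x y x' y', x \in `[0, 1] -> y \in `[0, 1] -> x' \in `[0, 1] -> y' \in `[0, 1] ->
    `|W (x', y') - W (x, y)| <=
      M * (`|x' - x| `^ Num.min alpha 1 + `|y' - y| `^ Num.min alpha 1).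
Proof.
move=> a0 L0; have [la lmax] := strict_floorP a0.
have [l0|] := posnP (strict_floor alpha).
  exists L; first exact: ltW.
  have a1 : alpha <= 1.
    by rewrite leNgt; apply/negP => h; have := lmax 1%N h; rewrite l0.
  have -> : Num.min alpha 1 = alpha by exact/min_idPl.
  move=> W [_ []]; rewrite l0 => D [D00 _ _] hW x y x' y' hx hy hx' hy'.
  have := hW _ _ _ _ hx hy hx' hy'.
  rewrite /taylor_poly big_ord1 big_mkcond big_ord1 /= D00 // subr0.
  by rewrite !expr0 !mulr1 divr1.
case lE: (strict_floor alpha) => [//|l] _.
have [C C0 hC] := taylor_linear_coef_bound R l.
have b0 : 0 < alpha - l.+1%:R by rewrite subr_gt0 -lE.
have a1 : 1 < alpha.
  by apply: le_lt_trans la; rewrite lE ler1n.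
have -> : Num.min alpha 1 = 1 by apply/min_idPr/ltW.
exists (C * (1 + L)); first by rewrite mulr_ge0 // addr_ge0 // ltW.
move=> W [W01 []]; rewrite lE => D [D00 DSl DSr] hW x y x' y' hx hy hx' hy'.
rewrite !powRr1 //.
have D10 u v : u \in `[0, 1] -> v \in `[0, 1] -> `|D 1%N 0%N (u, v)| <= C * (1 + L).
  move=> hu hv.
  have := hC (fun t => W (t, v)) (fun i => D i 0%N (u, v) / (i`!)%:R) _ _ _ (ltW L0) b0 hu.
  rewrite divr1; apply => [t ht|t ht]; first exact: W01.
  have := hW _ _ _ _ hu hv ht hv; rewrite subrr taylor_poly_horizontal.
  by rewrite normr0 powR0 ?addr0 // gt_eqF.
have D01 u v : u \in `[0, 1] -> v \in `[0, 1] -> `|D 0%N 1%N (u, v)| <= C * (1 + L).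
  move=> hu hv.
  have := hC (fun t => W (u, t)) (fun i => D 0%N i (u, v) / (i`!)%:R) _ _ _ (ltW L0) b0 hv.
  rewrite divr1; apply => [t ht|t ht]; first exact: W01.
  have := hW _ _ _ _ hu hv hu ht; rewrite subrr taylor_poly_vertical.
  by rewrite normr0 powR0 ?add0r // gt_eqF.
have h1 := @derive01_lipschitz _ (fun t => D 0%N 0%N (t, y')) (fun t => D 1%N 0%N (t, y'))
  (C * (1 + L)) (fun u hu => DSl 0%N 0%N isT u y' hu hy') (fun u hu =>
      D10 u y' hu hy') x x' hx hx'.
have h2 := @derive01_lipschitz _ (fun t => D 0%N 0%N (x, t)) (fun t => D 0%N 1%N (x, t))
  (C * (1 + L)) (fun u hu => DSr 0%N 0%N isT x u hx hu) (fun u hu =>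
      D01 x u hx hu) y y' hy hy'.
rewrite !D00 // in h1 h2.
have := ler_normD (W (x', y') - W (x, y')) (W (x, y') - W (x, y)).
rewrite addrA subrK; lra.
Qed.

(** * Conditioning on the latent points *)

(* [f] is rounded up to a multiple of [1 / N]: on the level sets, which are in [F],
   the conditional probability can be integrated by definition. *)
Lemma integral_level_sets d (T : measurableType d) (R : realType)
    (P : probability T R) (F : set (set T)) (E : set T) (p f : T -> R) (K N : nat) :
  F `<=` measurable -> measurable E -> cond_prob_version P F E p ->
  (forall w, 0 <= p w) ->
  (forall B, measurable B -> F (f @^-1` B)) -> (forall w, 0 <= f w < K%:R) ->
  (0 < N)%N ->
  (\int[P]_w (f w * \1_E w)%:E <= \int[P]_w ((f w + N%:R^-1) * p w)%:E)%E.
Proof.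
move=> FT mE [mp cp] p0 mf fK N0.
have N0' : 0 < N%:R :> R by rewrite ltr0n.
have mf' : measurable_fun setT f.
  by move=> _ B mB; rewrite setTI; apply/FT/mf.
have mp' : measurable_fun setT p.
  by move=> _ B mB; rewrite setTI; apply/FT/mp.
pose G (j : 'I_(K * N)) := f @^-1` `[j%:R / N%:R, j.+1%:R / N%:R[%classic.
pose c (j : 'I_(K * N)) : R := j.+1%:R / N%:R.
have c0 j : 0 <= c j by rewrite divr_ge0 // ltW.
have FG j : F (G j) by apply: mf; exact: measurable_itv.
have mG j : measurable (G j) by exact: FT.
have lev w : exists j, G j w.
  have /andP[w0 wK] := fK w.
  have fN0 : 0 <= f w * N%:R by rewrite mulr_ge0 // ltW.
  have /andP[t1 t2] := truncn_itv fN0.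
  have tK : (Num.truncn (f w * N%:R) < K * N)%N.
    rewrite truncn_lt_nat // natrM ltr_pM2r //.
  exists (Ordinal tK); rewrite /G /= in_itv /=; apply/andP; split.
    by rewrite ler_pdivrMr.
  by rewrite ltr_pdivlMr.
have G_itv j w : G j w -> f w <= c j /\ c j <= f w + N%:R^-1.
  rewrite /G /= in_itv /= => /andP[h1 h2]; split; first exact: ltW.
  by rewrite /c -natr1 mulrDl mul1r lerD2r.
have uniqG j j' w : G j w -> G j' w -> j = j'.
  rewrite /G /= !in_itv /= !ler_pdivrMr // !ltr_pdivlMr // => h h'.
  apply: val_inj => /=; rewrite -(truncn_def h); exact: truncn_def.
have mI A : measurable A -> measurable_fun setT (\1_A : T -> R).
  by move=> mA; exact: measurable_indic.
apply: (@le_trans _ _ (\int[P]_w (\sum_(j < K * N) (c j * \1_(G j `&` E) w)%:E)%R)%E).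
  apply: ge0_le_integral => //.
  - by move=> w _; rewrite lee_fin mulr_ge0 //; have /andP[] := fK w.
  - by apply/measurable_EFinP; apply: measurable_funM => //; exact: mI.
  - by apply: emeasurable_sum => j; apply/measurable_EFinP; apply: measurable_funM => //;
      apply: mI; exact: measurableI.
  move=> w _; rewrite sumEFin lee_fin.
  have [j Gj] := lev w; rewrite (bigD1 j) //=.
  apply: (@le_trans _ _ (c j * \1_(G j `&` E) w)).
    rewrite !indicE in_setI (mem_set Gj) /= ler_wpM2r //.
    by have [] := G_itv j w Gj.
  by rewrite lerDl; apply: sumr_ge0 => i _; rewrite mulr_ge0.
rewrite ge0_integral_sum //; last 2 first.
- by move=> j; apply/measurable_EFinP; apply: measurable_funM => //;
    apply: mI; exact: measurableI.
- by move=> j w _; rewrite lee_fin mulr_ge0.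
(* The level set [G j] is in [F], so the integral of [p] over it is the probability of its
   intersection with [E]. *)
have stepE j : (\int[P]_w (c j * \1_(G j `&` E) w)%:E = \int[P]_w (c j * (\1_(G j) w *
    p w))%:E)%E.
  under eq_integral do rewrite EFinM.
  rewrite ge0_integralZl_EFin //; last first.
    by apply/measurable_EFinP; apply: mI; exact: measurableI.
  under [RHS]eq_integral do rewrite EFinM.
  rewrite ge0_integralZl_EFin //; last 2 first.
  - by move=> w _; rewrite lee_fin mulr_ge0.
  - by apply/measurable_EFinP; apply: measurable_funM => //; exact: mI.
  congr (_ * _)%E.
  rewrite integral_indic ?setIT //; last exact: measurableI.
  transitivity (\int[P]_(w in G j) (p w)%:E)%E; first exact: cp.
  rewrite [LHS]integral_mkcond.
  apply: eq_integral => w _.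
  by rewrite patchE indicE; case: (w \in G j); rewrite ?mul1r ?mul0r.
under eq_bigr do rewrite stepE.
rewrite -ge0_integral_sum //; last 2 first.
- by move=> j; apply/measurable_EFinP; apply: measurable_funM => //;
    apply: measurable_funM => //; exact: mI.
- by move=> j w _; rewrite lee_fin !mulr_ge0.
apply: ge0_le_integral => //.
- by move=> w _; rewrite sumEFin lee_fin; apply: sumr_ge0 => j _; rewrite !mulr_ge0.
- by apply: emeasurable_sum => j; apply/measurable_EFinP; apply: measurable_funM => //;
    apply: measurable_funM => //; exact: mI.
- by apply/measurable_EFinP; apply: measurable_funM => //; exact: measurable_funD.
move=> w _; rewrite sumEFin lee_fin.
have [j Gj] := lev w; rewrite (bigD1 j) //= big1 ?addr0; last first.
  move=> i ij; rewrite indicE memNset ?mul0r ?mulr0 // => Gi.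
  by move/eqP: ij; apply; exact: uniqG Gi Gj.
rewrite indicE (mem_set Gj) mul1r ler_wpM2r //.
by have [] := G_itv j w Gj.
Qed.

(** Tower property for a finite-valued [A], by decomposition along its values. The rounding costs
    [N^-1] in total since the [p a w] sum to 1 over [a], and [N] is arbitrarily large. *)
Lemma expectation_le_conditional d (T : measurableType d) (R : realType)
    (P : probability T R) (D : finType) (A : T -> D) (F : set (set T))
    (p f : D -> T -> R) (H : T -> R) (K : nat) :
  F `<=` measurable -> (forall a, measurable [set w | A w = a]) ->
  (forall a, cond_prob_version P F [set w | A w = a] (p a)) ->
  (forall a w, 0 <= p a w) -> (forall w, \sum_a p a w = 1) ->
  (forall a B, measurable B -> F (f a @^-1` B)) ->
  (forall a w, 0 <= f a w < K%:R) -> measurable_fun setT H ->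
  (forall w, \sum_a p a w * f a w <= H w) ->
  (\int[P]_w (f (A w) w)%:E <= \int[P]_w (H w)%:E)%E.
Proof.
move=> FT mA cp p0 p1 mf fK mH fH.
have f0 a w : 0 <= f a w by have /andP[] := fK a w.
have mf' a : measurable_fun setT (f a).
  by move=> _ B mB; rewrite setTI; apply/FT/mf.
have mp' a : measurable_fun setT (p a).
  by move=> _ B mB; rewrite setTI; apply/FT/(proj1 (cp a)).
have mI E : measurable E -> measurable_fun setT (\1_E : T -> R).
  by move=> mE; exact: measurable_indic.
have H0 w : 0 <= H w.
  by apply: le_trans (fH w); apply: sumr_ge0 => a _; rewrite mulr_ge0.
have fAE w : f (A w) w = \sum_a f a w * \1_[set w | A w = a] w.
  rewrite (bigD1 (A w)) //= big1 ?addr0.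
    by rewrite indicE mem_set ?mulr1.
  by move=> a aA; rewrite indicE memNset ?mulr0 //= => h; rewrite h eqxx in aA.
apply/lee_addgt0Pr => e e0.
pose N := (Num.truncn (e^-1)).+1.
have Ne : N%:R^-1 <= e.
  by rewrite -[leRHS]invrK lef_pV2 ?posrE ?invr_gt0 ?ltr0n // ltW // truncnS_gt.
apply: (@le_trans _ _ (\int[P]_w (H w + N%:R^-1)%:E)%E); last first.
  under eq_integral do rewrite EFinD.
  rewrite ge0_integralD //; last 2 first.
  - by move=> w _; rewrite lee_fin.
  - by apply/measurable_EFinP.
  by rewrite leeD2l // integral_cst // [X in (_ * X)%E]probability_setT mule1 lee_fin.
apply: (@le_trans _ _ (\int[P]_w (\sum_a (f a w * \1_[set w | A w = a] w)%:E)%R)%E).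
  by under eq_integral do rewrite fAE -sumEFin.
rewrite ge0_integral_sum //; last 2 first.
- by move=> a; apply/measurable_EFinP; apply: measurable_funM => //; exact: mI.
- by move=> a w _; rewrite lee_fin mulr_ge0.
apply: (@le_trans _ _ (\sum_a \int[P]_w ((f a w + N%:R^-1) * p a w)%:E)%E).
  by apply: lee_sum => a _; apply: (integral_level_sets (F := F) (K := K) FT (mA a) (cp
      a)) => //; exact: mf.
rewrite -ge0_integral_sum //; last 2 first.
- by move=> a; apply/measurable_EFinP; apply: measurable_funM => //; exact: measurable_funD.
- by move=> a w _; rewrite lee_fin mulr_ge0 // addr_ge0.
apply: ge0_le_integral => //.
- by move=> w _; rewrite sumEFin lee_fin; apply: sumr_ge0 => a _; rewrite mulr_ge0 // addr_ge0.
- by apply: emeasurable_sum => a; apply/measurable_EFinP; apply: measurable_funM => //;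
    exact: measurable_funD.
- by apply/measurable_EFinP; exact: measurable_funD.
move=> w _; rewrite sumEFin lee_fin.
have -> : \sum_a (f a w + N%:R^-1) * p a w = \sum_a p a w * f a w + N%:R^-1 * \sum_a p a w.
  by rewrite mulr_sumr -big_split; apply: eq_bigr => a _ /=; ring.
by rewrite p1 mulr1 lerD2r.
Qed.

Lemma frobenius_norm_sym_hollowB (R : realType) (n : nat) (f g : 'I_n -> 'I_n -> R) :
  frobenius_norm (sym_hollow f - sym_hollow g) ^+ 2 =
  2 * \sum_(e : edge n) (f (val e).1 (val e).2 - g (val e).1 (val e).2) ^+ 2.
Proof.
rewrite /frobenius_norm sqr_sqrtr; last first.
  by apply: sumr_ge0 => i _; apply: sumr_ge0 => j _; exact: sqr_ge0.
rewrite (sum_pairs_edges (fun i j => (sym_hollow f - sym_hollow g) i j ^+ 2)).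
rewrite big1 ?add0r; last by move=> i _; rewrite !mxE ltnn subrr expr0n.
rewrite mulr_sumr; apply: eq_bigr => e _.
have e21 := valP e; rewrite !mxE e21 ltnNge (ltnW e21) /=; ring.
Qed.

Lemma Theta0_edge (R : realType) (n : nat) (rho : R) (W : R * R -> R) (x : 'I_n -> R)
    (e : edge n) :
  Theta0 rho W x (val e).1 (val e).2 = rho * W (x (val e).1, x (val e).2).
Proof. by rewrite mxE (valP e). Qed.

Lemma measurable_graphon_pair d (T : measurableType d) (R : realType)
    (W : R * R -> R) (f g : T -> R) :
  graphon W -> (forall w, f w \in `[0, 1]) -> (forall w, g w \in `[0, 1]) ->
  measurable_fun setT f -> measurable_fun setT g ->
  measurable_fun setT (fun w => W (f w, g w)).
Proof.
move=> [_ _ mW] f01 g01 mf mg.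
have mfg : measurable_fun setT (fun w => (f w, g w)) by exact: measurable_fun_pair.
apply: (measurable_comp _ _ mW mfg).
- by apply: measurableX; exact: measurable_itv.
- by move=> _ [w _ <-]; split => /=.
Qed.

Lemma sigma_generated_measurable d (T : measurableType d) (R : realType) (n : nat)
    (X : 'I_n -> T -> R) : (forall i, measurable_fun setT (X i)) ->
  sigma_generated X `<=` measurable.
Proof.
move=> mX; apply: smallest_sub; first exact: sigma_algebra_measurable.
by move=> E [i [B mB ->]]; rewrite -[_ @^-1` _]setTI; exact: mX.
Qed.

(** The sample space is given the sigma-algebra generated by the latent points as its measurable
    structure; the usual closure properties of measurable functions then apply. *)
Lemma sigma_generated_loss d (T : measurableType d) (R : realType) (n : nat)
    (W : R * R -> R) (X : 'I_n -> T -> R) (q : edge n -> R) (rho c : R) (B : set R) :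
  graphon W -> (forall i w, X i w \in `[0, 1]) -> measurable B ->
  sigma_generated X ((fun w => c * \sum_(e : edge n)
    (q e - rho * W (X (val e).1 w, X (val e).2 w)) ^+ 2) @^-1` B).
Proof.
move=> gW X01 mB.
pose G : set (set T) := [set E | exists i, exists2 B, measurable B & E = X i @^-1` B].
have mX i : measurable_fun setT (X i : g_sigma_algebraType G -> R).
  move=> _ C mC; rewrite setTI; apply: sub_sigma_algebra; by exists i, C.
suff mF : measurable_fun setT ((fun w => c * \sum_(e : edge n)
    (q e - rho * W (X (val e).1 w, X (val e).2 w)) ^+ 2) : g_sigma_algebraType G -> R).
  by have := mF measurableT B mB; rewrite setTI.
apply: measurable_funM => //; apply: measurable_sum => e.
apply: measurable_funX; apply: measurable_funB => //; apply: measurable_funM => //.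
exact: measurable_graphon_pair.
Qed.

(** Reduces the risk to the conditional risk at fixed latent points, on which the bound [H] may
    still depend. The factor 2 counts the two matrix entries of an edge. *)
Lemma mean_sq_error_le (R : realType) (n k : nat) (rho : R) (W : R * R -> R)
    d (T : measurableType d) (P : probability T R)
    (xi : 'I_n -> {RV P >-> R}) (A : T -> data n)
    (est : data n -> 'M[R]_k * {ffun 'I_n -> 'I_k}) (H : T -> R) :
  graphon W -> 0 <= rho <= 1 -> sparse_graphon_model rho W xi A ->
  measurable_fun setT H ->
  (forall w, 2 / n%:R ^+ 2 * (\sum_a bernoulli_weight
       (fun e : edge n => rho * W (xi (val e).1 w, xi (val e).2 w)) a *
     \sum_(e : edge n) ((est a).1 ((est a).2 (val e).1) ((est a).2 (val e).2)
        - rho * W (xi (val e).1 w, xi (val e).2 w)) ^+ 2) <= H w) ->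
  (mean_sq_error rho W xi A est <= \int[P]_w (H w)%:E)%E.
Proof.
move=> gW /andP[rho0 rho1] [xi01 _ _ mA cA] mH hH.
pose th w (e : edge n) := rho * W (xi (val e).1 w, xi (val e).2 w).
have W01 i j w : 0 <= W (xi i w, xi j w) <= 1.
  by have := graphon_unit gW (xi01 i w) (xi01 j w); rewrite in_itv.
have th01 w e : 0 <= th w e <= 1.
  by have /andP[h1 h2] := W01 (val e).1 (val e).2 w; rewrite /th; apply/andP; split;
    [exact: mulr_ge0|nra].
pose q (a : data n) (e : edge n) := (est a).1 ((est a).2 (val e).1) ((est a).2 (val e).2).
pose c : R := 2 / n%:R ^+ 2.
have c0 : 0 <= c by rewrite divr_ge0 ?exprn_ge0.
pose f a w := c * \sum_(e : edge n) (q a e - th w e) ^+ 2.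
pose p a w := bernoulli_weight (th w) a.
(* The data take finitely many values, so even an estimator without constraint on its entries has a
   bounded loss. *)
pose Bd := \sum_a c * \sum_(e : edge n) (`|q a e| + 1) ^+ 2.
have f0 a w : 0 <= f a w.
  by rewrite mulr_ge0 //; apply: sumr_ge0 => e _; exact: sqr_ge0.
have fB a w : f a w <= Bd.
  rewrite /Bd (bigD1 a) //=; apply: (@le_trans _ _ (c * \sum_(e : edge n) (`|q a e| +
      1) ^+ 2)).
    rewrite ler_wpM2l //; apply: ler_sum => e _.
    rewrite -[leLHS]real_normK ?num_real // lerXn2r ?nnegrE ?addr_ge0 //.
    apply: le_trans (ler_normB _ _) _; rewrite lerD2l.
    by have /andP[h1 h2] := th01 w e; rewrite ger0_norm.
  rewrite lerDl; apply: sumr_ge0 => i _; rewrite mulr_ge0 //.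
  by apply: sumr_ge0 => e _; exact: sqr_ge0.
have mxi i : measurable_fun setT (xi i : T -> R) by exact: measurable_funPT.
have -> : mean_sq_error rho W xi A est = (\int[P]_w (f (A w) w)%:E)%E.
  rewrite /mean_sq_error unlock; apply: eq_integral => w _; congr EFin.
  rewrite /Theta_hat /Theta0 frobenius_norm_sym_hollowB /f /c /q /th /=; ring.
apply: (@expectation_le_conditional _ _ _ P _ A (sigma_generated (fun i => xi i : T -> R))
   p f H (Num.truncn Bd).+1) => //.
- exact: sigma_generated_measurable.
- move=> a.
  have -> : [set w | A w = a] = \bigcap_(e in [set: edge n]) ((fun w =>
      A w e) @^-1` [set a e]).
    apply/seteqP; split => [w /= Awa e _|w h] /=; first by rewrite Awa.
    by apply/ffunP => e; exact: h.
  apply: fin_bigcap_measurable => [|e _]; first exact: finite_finset.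
  rewrite -[_ @^-1` _]setTI; exact: mA.
- move=> a; have := cA a; congr (cond_prob_version _ _ _ _).
  by apply/funext => w; apply: eq_bigr => e _; rewrite Theta0_edge.
- by move=> a w; exact: bernoulli_weight_ge0.
- by move=> w; exact: bernoulli_weight_sum.
- by move=> a B mB; exact: sigma_generated_loss.
- by move=> a w; rewrite f0 /= (le_lt_trans (fB a w)) // truncnS_gt.
move=> w; apply: le_trans (hH w); rewrite mulr_sumr.
by apply: ler_sum => a _; rewrite /f mulrCA.
Qed.

(** * Filling of the bins by the uniform latent points *)

Lemma uniform_prob_itv (R : realType) (a b : R) : 0 <= a -> a <= b -> b <= 1 ->
  uniform_prob (@ltr01 R) `[a, b[ = (b - a)%:E.
Proof.
move=> a0 ab b1; rewrite /uniform_prob.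
rewrite (eq_integral (cst 1%:E)); last first.
  move=> x; rewrite inE /= in_itv /= => /andP[x0 x1].
  by rewrite /uniform_pdf (le_trans a0 x0) (ltW (lt_le_trans x1 b1)) /= subr0 invr1.
rewrite integral_cst //= mul1e.
rewrite lebesgue_measure_itv /= lte_fin.
by case: ltP => // ba; have -> : a = b by [apply/eqP; rewrite eq_le ab ba]; rewrite subrr.
Qed.

(** Chernoff bound for the lower tail with parameter 1: [expR (m - #|S|) >= 1] on the sets
    concerned, and [1 - v + v * expR (-1) <= 1 - v / 2 <= expR (- v / 2)]. *)
Lemma few_successes_weight (R : realType) (n m : nat) (v : R) : 0 <= v <= 1 ->
  \sum_(S : {set 'I_n} | (#|S| < m)%N) \prod_i (if i \in S then v else 1 - v) <=
  expR (m%:R - n%:R * v / 2).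
Proof.
move=> /andP[v0 v1].
have h : expR (-1) <= 1 / 2 :> R.
  have := expR_ge1Dx (1 : R); rewrite expRN => h1.
  by rewrite div1r lef_pV2 ?posrE ?expR_gt0 //; lra.
have e0 : 0 <= expR (-1) :> R by rewrite ltW ?expR_gt0.
apply: (@le_trans _ _ (expR m%:R * \sum_(S : {set 'I_n})
    \prod_i (if i \in S then v * expR (-1) else 1 - v))).
  rewrite mulr_sumr big_mkcond; apply: ler_sum => S _.
  have -> : \prod_i (if i \in S then v * expR (-1) else 1 - v) =
      expR (- #|S|%:R) * \prod_i (if i \in S then v else 1 - v).
    have -> : - #|S|%:R = #|S|%:R * -1 :> R by ring.
    rewrite expRM_natl -prodr_const [X in _ = X * _]big_mkcond -big_split /=.
    by apply: eq_bigr => i _; case: (i \in S); rewrite ?mul1r // mulrC.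
  have p0 : 0 <= \prod_i (if i \in S then v else 1 - v).
    by apply: prodr_ge0 => i _; case: (i \in S) => //; lra.
  rewrite mulrA -expRD; case: ifPn => [hS|_]; last by rewrite mulr_ge0 // ltW ?expR_gt0.
  rewrite -[leLHS]mul1r ler_wpM2r // -[leLHS](@expR0 R) ler_expR subr_ge0 ler_nat.
  exact: ltnW.
rewrite -(bigA_distr _ _ (fun=> v * expR (-1)) (fun=> 1 - v)).
rewrite prodr_const card_ord expRD ler_wpM2l ?(ltW (expR_gt0 _)) //.
have -> : - (n%:R * v / 2) = n%:R * (- (v / 2)) by ring.
rewrite expRM_natl lerXn2r ?nnegrE ?(ltW (expR_gt0 _)) //.
  by rewrite /=; have := mulr_ge0 v0 e0; lra.
apply: le_trans (expR_ge1Dx _).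
have := ler_wpM2l v0 h; rewrite /=; lra.
Qed.

Lemma low_bin_count_prob (R : realType) (n K m : nat) (rho : R) (W : R * R -> R)
    d (T : measurableType d) (P : probability T R)
    (xi : 'I_n -> {RV P >-> R}) (A : T -> data n) (t : 'I_K) :
  (0 < K)%N -> sparse_graphon_model rho W xi A ->
  let E := [set w | (bin_count (fun i => xi i w) t < m)%N] in
  measurable E /\ (P E <= (expR (m%:R - n%:R / (2 * K%:R)))%:E)%E.
Proof.
move=> K0 [xi01 xiU xiI _ _] E.
have K0' : 0 < K%:R :> R by rewrite ltr0n.
pose B : set R := `[t%:R / K%:R, t.+1%:R / K%:R[%classic.
have mB : measurable B by exact: measurable_itv.
pose BS (S : {set 'I_n}) i : set R := if i \in S then B else ~` B.
have mBS S i : measurable (BS S i).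
  by rewrite /BS; case: (i \in S) => //; exact: measurableC.
pose ES (S : {set 'I_n}) := \bigcap_i (xi i @^-1` BS S i).
have mxi i C : measurable C -> measurable (xi i @^-1` C).
  by move=> mC; rewrite -[_ @^-1` _]setTI; exact: (measurable_funPT (xi i)).
have mES S : measurable (ES S).
  by apply: fin_bigcap_measurable => [|i _]; [exact: finite_finset|exact: mxi].
have PB i : P (xi i @^-1` B) = (K%:R^-1)%:E.
  have := xiU i B mB; rewrite /distribution /pushforward => ->.
  rewrite uniform_prob_itv.
  - by congr EFin; rewrite -mulrBl -natr1 addrAC subrr add0r mul1r.
  - by rewrite divr_ge0.
  - by rewrite ler_pM2r ?invr_gt0 // ler_nat.
  - by rewrite ler_pdivrMr // mul1r ler_nat.
have PBS S i : P (xi i @^-1` BS S i) = (if i \in S then K%:R^-1 else 1 - K%:R^-1)%:E.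
  rewrite /BS; case: (i \in S); first exact: PB.
  have := probability_setC P (mxi i B mB); rewrite preimage_setC => ->.
  by rewrite [X in (_ - X)%E]PB.
have PES S : P (ES S) = (\prod_i (if i \in S then K%:R^-1 else 1 - K%:R^-1))%:E.
  rewrite /ES xiI //; rewrite -prodEFin; apply: eq_bigr => i _; exact: PBS.
pose few := enum [pred S : {set 'I_n} | (#|S| < m)%N].
(* The event is split according to the exact set [S] of points falling in the bin; by independence
   each piece has a product probability. *)
have EE : E = \bigcup_(S in [set` few]) ES S.
  apply/seteqP; split => [w Ew|w [S /=]].
    exists [set l | (t%:R / K%:R <= xi l w)%R && (xi l w < t.+1%:R / K%:R)%R]%SET.
      by rewrite /= mem_enum.
    move=> i _ /=; rewrite /BS inE.
    case: ifPn => h; first by rewrite /B /= in_itv.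
    by apply/negP: h; rewrite /B /= in_itv.
  rewrite mem_enum inE => Sm hS.
  rewrite /E /= /bin_count; apply: leq_ltn_trans Sm.
  apply/subset_leq_card/fintype.subsetP => l; rewrite inE => h.
  by have := hS l I; rewrite /= /BS; case: (l \in S) => //; rewrite /B /= in_itv /= h.
have fin : finite_set [set` few] by exact: finite_seq.
have mE : measurable E.
  by rewrite EE; apply: fin_bigcup_measurable => // S _; exact: mES.
split => //.
have sub : E `<=` \bigcup_(S in [set` few]) ES S by rewrite EE.
have := @content_sub_fsum _ _ _ P _ _ _ _ fin (fun S _ => mES S) mE sub.
rewrite -fsbig_seq ?enum_uniq // big_enum /= => h; apply: (le_trans h).
under eq_bigr do rewrite PES.
rewrite sumEFin lee_fin.
have iK : 0 <= (K%:R^-1 : R) <= 1.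
  by rewrite invr_ge0 ler0n /= invf_le1 // ler1n.
apply: le_trans (few_successes_weight n m iK) _.
by rewrite (_ : n%:R * K%:R^-1 / 2 = n%:R / (2 * K%:R)) // invfM; ring.
Qed.

(** * The number of blocks *)

Lemma absz_ceil_bounds (R : realType) (x : R) : 0 < x ->
  x <= (`|Num.ceil x|%N)%:R < x + 1.
Proof.
move=> x0; have c0 : (0 <= Num.ceil x)%R by rewrite ltW // ceil_gt0.
have -> : (`|Num.ceil x|%N)%:R = (Num.ceil x)%:~R :> R.
  by rewrite natr_absz (ger0_norm c0).
rewrite ceil_ge /=; have := ceil_itv x; rewrite rmorphB /= => /andP[h _]; lra.
Qed.

Lemma powR_expR_ln (R : realType) (x y : R) : 0 < x -> x `^ y = expR (y * ln x).
Proof. by move=> x0; rewrite /powR gt_eqF. Qed.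

Lemma expR1_le4 (R : realType) : expR 1 <= 4 :> R.
Proof.
have h : expR (1 / 2) <= 2 :> R.
  by apply: le_trans (expR_le_quadratic (lexx _)) _; lra.
have -> : expR 1 = expR (1 / 2) * expR (1 / 2) :> R by rewrite -expRD; congr expR; lra.
have -> : 4 = 2 * 2 :> R by lra.
by rewrite ler_pM ?expR_ge0.
Qed.

Definition block_scale (R : realType) (a rho : R) (n : nat) : R :=
  (rho `^ (1 / 2) * n%:R) `^ (1 / (1 + a)).

(** In the dense regime the bias bound is the first term of the rate; in the sparse one it is at
    most [rho / n], hence below the logarithmic term because [ln (rho * n) >= 1]. *)
Lemma num_blocks_bounds (R : realType) (alpha rho : R) (n : nat) :
  0 < alpha -> (0 < n)%N -> 4 / n%:R < rho -> rho <= 1 ->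
  let a := Num.min alpha 1 in let k := num_blocks alpha rho n in
  [/\ (2 <= k)%N, 1 <= ln (rho * n%:R),
      k%:R <= 2 * block_scale a rho n,
      rho ^+ 2 * (k%:R^-1 `^ a) ^+ 2 <= error_rate alpha rho rho n &
      (k <= n)%N -> ln k%:R <= (1 + a^-1) * ln (rho * n%:R)].
Proof.
move=> alpha0 n0 rho4 rho1 a k.
have a0 : 0 < a by rewrite lt_min alpha0 ltr01.
have a1 : a <= 1 by rewrite ge_min lexx orbT.
have n0' : 0 < n%:R :> R by rewrite ltr0n.
have rho0 : 0 < rho by apply: lt_trans rho4; rewrite divr_gt0.
have rn4 : 4 < rho * n%:R by rewrite -ltr_pdivrMr.
have rn0 : 0 < rho * n%:R by lra.
have ln1 : 1 <= ln (rho * n%:R).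
  rewrite -[leLHS]expRK ler_ln ?posrE ?expR_gt0 //.
  by apply: le_trans (expR1_le4 R) _; lra.
(* Both regimes reduce to linear inequalities between [p] and [v]. *)
set p := ln rho; pose v : R := ln n%:R.
have lnE : ln (rho * n%:R) = p + v by rewrite lnM ?posrE.
have rhoE : rho = expR p by rewrite lnK ?posrE.
have nE : n%:R = expR v by rewrite lnK ?posrE.
have p0 : p <= 0 by exact: ln_le0.
have a10 : 0 < 1 + a by lra.
pose kap := block_scale a rho n.
have kapE : kap = expR ((p / 2 + v) / (1 + a)).
  rewrite /kap /block_scale powR_expR_ln ?mulr_gt0 ?powR_gt0 //; congr expR.
  rewrite lnM ?posrE ?powR_gt0 // ln_powR -/p -/v; field.
  by rewrite gt_eqF.
pose u := expR ((p + v) / (2 * a)).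
have uE : (rho * n%:R) `^ (1 / (2 * a)) = u.
  rewrite powR_expR_ln // lnE /u; congr expR; field; by rewrite gt_eqF.
have regE : (n%:R `^ (a - 1) <= rho) = ((a - 1) * v <= p).
  by rewrite powR_expR_ln // {1}rhoE ler_expR.
have kap1 : 1 < kap.
  by rewrite kapE expR_gt1 divr_gt0 //; lra.
have u1 : 1 < u.
  by rewrite expR_gt1 divr_gt0 //; lra.
have rateE : error_rate alpha rho rho n =
    expR ((2 + a) / (1 + a) * p - 2 * a / (1 + a) * v) + rho * (p + v) / n%:R.
  by rewrite /error_rate -/a !powR_expR_ln // lnE -expRD -/p -/v mulNr.
have ceilB (x : R) : 1 < x -> let c := `|Num.ceil x|%N in
    [/\ (2 <= c)%N, x <= c%:R & c%:R <= 2 * x].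
  move=> x1 c; have /andP[h1 h2] := absz_ceil_bounds (lt_trans ltr01 x1).
  split=> //; last by rewrite -/c in h2; lra.
  by rewrite -/c in h1; rewrite -(ltr_nat R) (lt_le_trans x1).
have sqE (c x : R) : 0 < x -> x <= c -> (c^-1 `^ a) ^+ 2 <= expR (- (2 * a) * ln x).
  move=> x0 xc; have c0 : 0 < c by exact: lt_le_trans xc.
  rewrite powR_expR_ln ?invr_gt0 // -expRM_natl ler_expR lnV ?posrE //.
  have : ln x <= ln c by rewrite ler_ln ?posrE.
  by move: (ln c) (ln x) => lc lx h; nra.
rewrite /k /num_blocks -/a regE; case: ifP => reg.
  have := ceilB _ kap1; rewrite /kap /block_scale => -[]; set c := `|_|%N => c2 c3 c4.
  split=> //.
    apply: (@le_trans _ _ (expR ((2 + a) / (1 + a) * p - 2 * a / (1 + a) * v))); last first.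
      by rewrite rateE lerDl divr_ge0 ?mulr_ge0 //; lra.
    have := sqE _ _ (lt_trans ltr01 kap1) c3.
    rewrite kapE expRK => h.
    apply: le_trans (ler_wpM2l (sqr_ge0 _) h) _.
    rewrite {1}rhoE -expRM_natl -expRD ler_expR le_eqVlt; apply/orP; left; apply/eqP.
    by field; rewrite gt_eqF.
  (* In this regime [(a - 1) * v <= p], that is [v <= a^-1 * (p + v)], so the trivial bound [k <= n]
     is enough. *)
  move=> cn; apply: (@le_trans _ _ v).
    by rewrite ler_ln ?posrE ?ltr0n ?ler_nat // (leq_trans _ c2).
  rewrite lnE; apply: (@le_trans _ _ (a^-1 * (p + v))).
    rewrite mulrC ler_pdivlMr //; lra.
  by rewrite ler_wpM2r //; lra.
have {reg} reg : p < (a - 1) * v by rewrite ltNge reg.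
have := ceilB _ u1; rewrite -uE => -[]; set c := `|_|%N => c2 c3 c4.
rewrite uE in c3 c4.
split=> //.
(* [u <= kap] amounts to [p <= (a - 1) * v], the condition of the sparse regime. *)
- apply: le_trans c4 _; rewrite ler_pM2l // -/kap kapE /u ler_expR.
  rewrite ler_pdivrMr ?mulr_gt0 // mulrAC ler_pdivlMr //; nra.
- apply: (@le_trans _ _ (rho * (p + v) / n%:R)); last first.
    by rewrite rateE lerDr ltW ?expR_gt0.
  have := sqE _ _ (lt_trans ltr01 u1) c3; rewrite /u expRK => h.
  apply: le_trans (ler_wpM2l (sqr_ge0 _) h) _.
  apply: (@le_trans _ _ (rho / n%:R)).
    rewrite {1}rhoE -expRM_natl -expRD [in leRHS]rhoE nE -expRN -expRD ler_expR.
    rewrite le_eqVlt; apply/orP; left; apply/eqP.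
    by field; rewrite gt_eqF.
  rewrite -mulrA mulrCA; apply: ler_peMl; last by rewrite -lnE.
  by rewrite divr_ge0 // ltW.
move=> _; rewrite lnE; apply: (@le_trans _ _ (ln (2 * u))).
  by rewrite ler_ln ?posrE ?ltr0n ?mulr_gt0 ?expR_gt0 // (leq_trans _ c2).
rewrite lnM ?posrE ?expR_gt0 // /u expRK.
have ln2 : ln 2 <= 1 :> R.
  by have := le_ln1Dx (_ : -1 < 1 :> R); rewrite -natr1 addrC; apply; lra.
have : (p + v) / (2 * a) <= a^-1 * (p + v).
  rewrite mulrC invfM ler_wpM2r //; first by lra.
  by rewrite ger_pMl ?invr_gt0 //; lra.
by rewrite lnE in ln1; move=> h; rewrite [(1 + a^-1) * _]mulrDl mul1r; lra.
Qed.

(** The logarithms of the two sides differ by [(ln r - ln rho) / (1 + a)], which is 0 when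
    [r = rho]. *)
Lemma block_scale_rate (R : realType) (a rho r : R) (n : nat) :
  0 < a -> (0 < n)%N -> 0 < rho -> rho <= r ->
  r * block_scale a rho n ^+ 2 / n%:R ^+ 2 <=
  r `^ ((2 + a) / (1 + a)) * n%:R `^ (- (2 * a / (1 + a))).
Proof.
move=> a0 n0 rho0 rhor.
have n0' : 0 < n%:R :> R by rewrite ltr0n.
have r0 : 0 < r by exact: lt_le_trans rhor.
set p := ln rho; pose v : R := ln n%:R; set q := ln r.
have pq : p <= q by rewrite ler_ln ?posrE.
have a10 : 0 < 1 + a by lra.
have rE : r = expR q by rewrite lnK ?posrE.
have nE : n%:R = expR v by rewrite lnK ?posrE.
rewrite /block_scale powR_expR_ln ?mulr_gt0 ?powR_gt0 //.
rewrite lnM ?posrE ?powR_gt0 // ln_powR -/p -/v.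
rewrite !powR_expR_ln // -/q -/v {1}rE nE -!expRM_natl -expRN -!expRD ler_expR.
have -> : (2 + a) / (1 + a) * q + - (2 * a / (1 + a)) * v =
  q + 2 * (1 / (1 + a) * (1 / 2 * p + v)) + - (2 * v) + (q - p) / (1 + a).
  by field; rewrite gt_eqF.
by rewrite lerDl divr_ge0 ?subr_ge0 // ltW.
Qed.

(** The lower bound on [rho] is the conclusion in disguise: after taking logarithms both read [(1 +
    a) * y <= (1 + 2 * a) * p / 2 + a * v], where [p], [v] and [y] are the logarithms of [rho], [n]
    and [ln (rho * n)]. *)
Lemma block_scale_log (R : realType) (a rho : R) (n : nat) :
  0 < a -> (0 < n)%N -> 0 < rho -> 1 <= ln (rho * n%:R) ->
  n%:R `^ (- (2 * a / (1 + 2 * a)))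
    * ln (n%:R * rho) `^ (2 * (1 + a) / (1 + 2 * a)) <= rho ->
  block_scale a rho n * ln (rho * n%:R) <= rho * n%:R.
Proof.
move=> a0 n0 rho0; rewrite [n%:R * rho]mulrC.
have n0' : 0 < n%:R :> R by rewrite ltr0n.
set l := ln (rho * n%:R) => l1; have l0 : 0 < l by lra.
set p := ln rho; pose v : R := ln n%:R.
have rhoE : rho = expR p by rewrite lnK ?posrE.
have nE : n%:R = expR v by rewrite lnK ?posrE.
have a10 : 0 < 1 + a by lra.
have a20 : 0 < 1 + 2 * a by lra.
rewrite !powR_expR_ln // -expRD {1}rhoE ler_expR -/v => h.
rewrite /block_scale powR_expR_ln ?mulr_gt0 ?powR_gt0 //.
rewrite lnM ?posrE ?powR_gt0 // ln_powR -/p -/v.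
have -> : rho * n%:R = expR (p + v) by rewrite expRD -rhoE -nE.
rewrite -{1}[l]lnK ?posrE // -!expRD ler_expR.
set y := ln l in h *.
have {}h : (1 + a) * y <= (1 + 2 * a) * p / 2 + a * v.
  rewrite -(ler_pM2l (_ : 0 < 2 / (1 + 2 * a))); last by rewrite divr_gt0.
  have e1 : 2 / (1 + 2 * a) * ((1 + a) * y) = - (2 * a / (1 + 2 * a)) * v +
      2 * (1 + a) / (1 + 2 * a) * y + 2 * a / (1 + 2 * a) * v.
    by field; rewrite gt_eqF.
  have e2 : 2 / (1 + 2 * a) * ((1 + 2 * a) * p / 2 + a * v) = p + 2 * a / (1 + 2 * a) * v.
    by field; rewrite gt_eqF.
  by rewrite e1 e2 lerD2r.
rewrite -(ler_pM2l a10).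
have -> : (1 + a) * (1 / (1 + a) * (1 / 2 * p + v) + y) = p / 2 + v + (1 + a) * y.
  by field; rewrite gt_eqF.
by lra.
Qed.

(** * Rates *)

Definition risk_const (R : realType) : R := 64 * ln (grid_const R) + 65.

(** The oracle inequality with the [k ^ 2] ordered pairs of labels as blocks and all the [k ^ n]
    maps as assignments. *)
Lemma least_squares_risk (R : realType) (n k n0 : nat) (th : edge n -> R) (r : R)
    (Qs : set 'M[R]_k) (est : data n -> 'M[R]_k * {ffun 'I_n -> 'I_k})
    (good : pred (data n)) (Q : 'M[R]_k) (z : {ffun 'I_n -> 'I_k}) :
  0 < r -> (0 < k)%N -> (forall e, 0 <= th e <= 1) -> (forall e, th e <= r) ->
  (forall a, ls_minimizer Qs (assignments n k n0) a (est a)) ->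
  Qs Q -> z \in assignments n k n0 -> (forall b c, 0 <= Q b c <= 1) ->
  (forall a, good a -> forall b c, `|(est a).1 b c| <= r) ->
  (forall a, ~~ good a -> forall b c, 0 <= (est a).1 b c <= 1) ->
  \sum_a bernoulli_weight th a * \sum_(e : edge n)
      ((est a).1 ((est a).2 (val e).1) ((est a).2 (val e).2) - th e) ^+ 2 <=
  2 * \sum_(e : edge n) (Q (z (val e).1) (z (val e).2) - th e) ^+ 2
  + r * (risk_const R * (n%:R * ln k%:R + k%:R ^+ 2 + 1))
  + 5 * #|{: edge n}|%:R * \sum_(a | ~~ good a) bernoulli_weight th a.
Proof.
move=> r0 k0 th01 thr minest QQ zZ Q01 goodr bad01.
pose bl (z : {ffun 'I_n -> 'I_k}) (e : edge n) := (z (val e).1, z (val e).2).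
have := @oracle_inequality R (edge n) ('I_k * 'I_k)%type {ffun 'I_n -> 'I_k} bl th
  (fun e => Q (z (val e).1) (z (val e).2)) r (fun a => (est a).2)
  (fun a b => (est a).1 b.1 b.2) good r0 th01 thr.
move=> /(_ (fun e => Q01 _ _)) h.
have {}h := h (fun a => let: And3 _ _ m := minest a in m Q z QQ zZ).
have {h} := h (fun a ga b => goodr a ga b.1 b.2) (fun a ga b => bad01 a ga b.1 b.2).
rewrite card_ffun card_prod !card_ord /= => h; apply: (le_trans h).
rewrite lerD2r lerD2l ler_pM2l //.
have lng : 0 <= ln (grid_const R) by rewrite ln_ge0 // grid_const_ge1.
have k0' : 0 < k%:R :> R by rewrite ltr0n.
have lk : 0 <= n%:R * ln k%:R :> R by rewrite mulr_ge0 // ln_ge0 // ler1n.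
rewrite natrX lnXn // natrM -[ln _ *+ n]mulr_natl -expr2 /risk_const.
have k2 := sqr_ge0 (k%:R : R).
move: lng lk k2; move: (ln (grid_const R)) (n%:R * ln k%:R) (k%:R ^+ 2) => g x y g0 x0 y0.
have : 0 <= g * x by exact: mulr_ge0.
have : 0 <= g * y by exact: mulr_ge0.
lra.
Qed.

(** Entries are averages of 0-1 data over blocks, which are nonempty, even on the diagonal, because
    the fibers have at least two points. *)
Lemma least_squares_entries (R : realType) (n k n0 : nat) (a : data n)
    (Qz : 'M[R]_k * {ffun 'I_n -> 'I_k}) (b c : 'I_k) (r : R) :
  (2 <= n0)%N -> ls_minimizer (@sym_matrices R k) (assignments n k n0) a Qz ->
  0 <= Qz.1 b c <= 1 /\ (no_dense_cut n0 r a -> Qz.1 b c <= r).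
Proof.
move=> n02 minQ; have := least_squares_block_mean b c minQ.
set Ab := [set i | Qz.2 i == b]%SET; set Ac := [set i | Qz.2 i == c]%SET.
have [_ zZ _] := minQ; move: zZ; rewrite inE => /forallP fib.
have nb : (n0 <= #|Ab|)%N by exact: fib.
have nc : (n0 <= #|Ac|)%N by exact: fib.
have N0 : (0 < #|cross Ab Ac|)%N.
  have := card_cross_ge (leq_trans n02 nb) (leq_trans n02 nc).
  case: #|cross Ab Ac| => //; rewrite muln0 leqn0 muln_eq0.
  by case/orP=> /eqP h; [move: nb|move: nc]; rewrite h leqNgt (ltnW n02).
pose N : R := #|cross Ab Ac|%:R; pose s : R := \sum_(e | cross Ab Ac e) (a e)%:R.
rewrite /= -/N -/s => h.
have Np : 0 < N by rewrite ltr0n.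
have s0 : 0 <= s by exact: sumr_ge0.
have sN : s <= N.
  have -> : N = \sum_(e | cross Ab Ac e) 1 by rewrite /N -sum1_card natr_sum; apply: eq_bigl.
  by apply: ler_sum => e _; case: (a e).
split.
  by apply/andP; split; rewrite -(ler_pM2l Np) h ?mulr0 ?mulr1.
move=> /forallP/(_ Ab)/forallP/(_ Ac); rewrite nb nc /= -/N -/s => h2.
by rewrite -(ler_pM2l Np) h mulrC.
Qed.

Lemma exists_bin_map (R : realType) (n k : nat) (x : 'I_n -> R) :
  (0 < k)%N -> (forall i, 0 <= x i <= 1) ->
  exists f : 'I_n -> 'I_k, forall i j, f i = f j -> `|x i - x j| <= k%:R^-1.
Proof.
move=> k0 x01; have k0' : 0 < k%:R :> R by rewrite ltr0n.
(* The minimum puts the point 1 in the last bin. *)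
have flt i : (minn (Num.truncn (x i * k%:R)) k.-1 < k)%N.
  by rewrite (leq_ltn_trans (geq_minr _ _)) // prednK.
exists (fun i => Ordinal (flt i)).
have bin i : exists2 m : nat, m = Ordinal (flt i) & m%:R <= x i * k%:R <= m.+1%:R.
  exists (Ordinal (flt i)) => //=.
  have /andP[x0 x1] := x01 i.
  have /andP[h1 h2] := truncn_itv (mulr_ge0 x0 (ltW k0')).
  set t := Num.truncn _ in h1 h2 *.
  have [tk|tk] := leqP t k.-1; first by rewrite h1 ltW.
  rewrite prednK //; apply/andP; split; last by rewrite ger_pMl.
  by apply: le_trans h1; rewrite ler_nat ltnW.
move=> i j /(congr1 val) fij; have [m mi /andP[i1 i2]] := bin i.
have [m' mj /andP[j1 j2]] := bin j.
have mm : m' = m by rewrite mi mj; exact: esym fij.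
rewrite mm in j1 j2; rewrite -natr1 in i2 j2.
rewrite -[k%:R^-1]mul1r ler_pdivlMr // -[X in _ * X <= _](gtr0_norm k0') -normrM mulrBl.
by rewrite ler_norml; apply/andP; split; lra.
Qed.

Lemma sum_edges_le (R : realType) (n : nat) (f : edge n -> R) (c : R) :
  0 <= c -> (forall e, f e <= c) -> \sum_e f e <= n%:R ^+ 2 * c.
Proof.
move=> c0 fc; apply: (@le_trans _ _ (#|{: edge n}|%:R * c)).
  by rewrite mulr_natl -sumr_const; apply: ler_sum.
rewrite ler_wpM2r // -natrX ler_nat.
by have := card_edge_le n; lia.
Qed.

(** Some bins may be empty, whereas all fibers have to be nonempty; refining the bins into exactly
    [k] classes does not increase the diameters. *)
Lemma surjective_approximation (R : realType) (n k : nat) (W : R * R -> R)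
    (M a rho : R) (x : 'I_n -> R) :
  graphon W ->
  (forall x y x' y', x \in `[0, 1] -> y \in `[0, 1] -> x' \in `[0, 1] -> y' \in `[0, 1] ->
    `|W (x', y') - W (x, y)| <= M * (`|x' - x| `^ a + `|y' - y| `^ a)) ->
  0 <= M -> 0 <= a -> 0 <= rho -> (forall i, x i \in `[0, 1]) ->
  (0 < k)%N -> (k <= n)%N ->
  exists Q : 'M[R]_k, exists z : {ffun 'I_n -> 'I_k},
  [/\ sym_matrices Q, forall b c, 0 <= Q b c <= rho, z \in assignments n k 1 &
   \sum_(e : edge n) (Q (z (val e).1) (z (val e).2) -
      rho * W (x (val e).1, x (val e).2)) ^+ 2 <=
   n%:R ^+ 2 * (rho ^+ 2 * (4 * M ^+ 2 * (k%:R^-1 `^ a) ^+ 2))].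
Proof.
move=> gW lipW M0 a0 rho0 x01 k0 kn.
have x01' i : 0 <= x i <= 1 by have := x01 i; rewrite in_itv.
have [f hf] := exists_bin_map k0 x01'.
have [z zsurj zf] := exists_surjective_refinement f kn.
have [Q [sQ Qr] hQ] := exists_block_approximation gW lipW M0 a0 rho0 x01 zsurj
  (fun i j zij => hf i j (zf i j zij)).
exists Q, z; split => //.
  rewrite inE; apply/forallP => b; have [i zi] := zsurj b.
  by apply/card_gt0P; exists i; rewrite inE zi.
apply: sum_edges_le => [|e]; last exact: hQ.
by rewrite !mulr_ge0 ?sqr_ge0.
Qed.

(* When [k < D] there is no bin and the bound is the trivial one. *)
Lemma balanced_approximation (R : realType) (n k n0 D : nat) (W : R * R -> R)
    (M a rho : R) (x : 'I_n -> R) :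
  graphon W ->
  (forall x y x' y', x \in `[0, 1] -> y \in `[0, 1] -> x' \in `[0, 1] -> y' \in `[0, 1] ->
    `|W (x', y') - W (x, y)| <= M * (`|x' - x| `^ a + `|y' - y| `^ a)) ->
  0 <= M -> 0 <= a <= 1 -> 0 <= rho -> (forall i, x i \in `[0, 1]) ->
  (0 < k)%N -> (0 < n0)%N -> k = (n %/ n0)%N -> (0 < D)%N ->
  exists Q : 'M[R]_k, exists z : {ffun 'I_n -> 'I_k},
  [/\ sym_matrices Q, forall b c, 0 <= Q b c <= rho, z \in assignments n k n0 &
   \sum_(e : edge n) (Q (z (val e).1) (z (val e).2) -
      rho * W (x (val e).1, x (val e).2)) ^+ 2 <=
   n%:R ^+ 2 * (rho ^+ 2 * (64 * M ^+ 2 * D%:R ^+ 2 * (k%:R^-1 `^ a) ^+ 2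
     + \sum_(t < k %/ D) (bin_count x t < 2 * n0)%N%:R))].
Proof.
move=> gW lipW M0 /andP[a0 a1] rho0 x01 k0 n00 kE D0.
have x01' i : 0 <= x i <= 1 by have := x01 i; rewrite in_itv.
have x1 i j : `|x i - x j| <= 1.
  have /andP[? ?] := x01' i; have /andP[? ?] := x01' j.
  by rewrite ler_norml; apply/andP; split; lra.
have k0' : 0 < k%:R :> R by rewrite ltr0n.
have D0' : 0 < D%:R :> R by rewrite ltr0n.
have [z zZ zd] := exists_consecutive_assignment x k0 n00 kE.
have zsurj b : exists i, z i = b.
  move: zZ; rewrite inE => /forallP/(_ b) h.
  have /card_gt0P[i] := leq_trans n00 h; rewrite inE => /eqP zi; by exists i.
have S0 : 0 <= \sum_(t < k %/ D) (bin_count x t < 2 * n0)%N%:R :> R by exact: sumr_ge0.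
(* Common part of the two cases in which the diameters are [O(D / k)]; the constant [64 * D ^ 2] is
   [4 * (4 * D) ^ 2]. *)
have approx (eps : R) : (forall i j, z i = z j -> `|x i - x j| <= eps) ->
    eps <= 4 * D%:R * k%:R^-1 ->
  exists Q : 'M[R]_k, exists z : {ffun 'I_n -> 'I_k},
  [/\ sym_matrices Q, forall b c, 0 <= Q b c <= rho, z \in assignments n k n0 &
   \sum_(e : edge n) (Q (z (val e).1) (z (val e).2) -
      rho * W (x (val e).1, x (val e).2)) ^+ 2 <=
   n%:R ^+ 2 * (rho ^+ 2 * (64 * M ^+ 2 * D%:R ^+ 2 * (k%:R^-1 `^ a) ^+ 2
     + \sum_(t < k %/ D) (bin_count x t < 2 * n0)%N%:R))].
  move=> zeps epsk.
  have [Q [sQ Qr] hQ] := exists_block_approximation gW lipW M0 a0 rho0 x01 zsurj zeps.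
  exists Q, z; split => //; apply: sum_edges_le => [|e].
    by rewrite !mulr_ge0 ?addr_ge0 ?mulr_ge0 ?sqr_ge0.
  apply: le_trans (hQ _ _) _; rewrite ler_wpM2l ?sqr_ge0 //.
  have [i0 _] := zsurj (Ordinal k0).
  have eps0 : 0 <= eps by apply: le_trans (zeps i0 i0 erefl); exact: normr_ge0.
  have D1 : 1 <= D%:R :> R by rewrite ler1n.
  have D4 : 1 <= 4 * D%:R :> R by lra.
  have k1 : 0 <= k%:R^-1 `^ a by exact: powR_ge0.
  have e1 : eps `^ a <= 4 * D%:R * k%:R^-1 `^ a.
    apply: (@le_trans _ _ ((4 * D%:R * k%:R^-1) `^ a)).
      by rewrite ge0_ler_powR ?nnegrE // (le_trans eps0).
    rewrite powRM ?invr_ge0 ?mulr_ge0 // ler_wpM2r //.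
    by apply: le_trans (_ : (4 * D%:R) `^ 1 <= _);
        [exact: ler_powR|rewrite powRr1 // mulr_ge0].
  have e2 : (eps `^ a) ^+ 2 <= (4 * D%:R * k%:R^-1 `^ a) ^+ 2.
    by rewrite lerXn2r ?nnegrE ?powR_ge0 ?mulr_ge0.
  have M4 : 0 <= 4 * M ^+ 2 by rewrite mulr_ge0 ?sqr_ge0.
  apply: (le_trans (ler_wpM2l M4 e2)); rewrite -[leLHS]addr0; apply: lerD => //.
  by rewrite le_eqVlt; apply/orP; left; apply/eqP; ring.
have [kD|Dk] := ltnP k D.
  apply: (approx 1).
    by move=> i j _; exact: x1.
  rewrite ler_pdivlMr // mul1r.
  have : k%:R <= D%:R :> R by rewrite ler_nat ltnW.
  lra.
pose K := (k %/ D)%N.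
have K0 : (0 < K)%N by rewrite divn_gt0.
(* Full bins force diameters of at most [2 / K], and [k <= 2 * D * K]. *)
have [/forallP full|] := boolP [forall t : 'I_K, (2 * n0 <= bin_count x t)%N].
  apply: (approx (2 / K%:R)).
    move=> i j zij.
    wlog xij : i j zij / x i < x j.
      move=> hw; have [h|h|->] := ltgtP (x i) (x j); first exact: hw.
        by rewrite distrC; exact: hw.
      by rewrite subrr normr0 divr_ge0.
    rewrite distrC ger0_norm ?subr_ge0 ?(ltW xij) //.
    exact: (diameter_of_full_bins K0 x01' full (zd i j zij xij)).
  have K0' : 0 < K%:R :> R by rewrite ltr0n.
  rewrite ler_pdivrMr // mulrAC ler_pdivlMr //.
  have : k%:R <= 2 * D%:R * K%:R :> R.
    have K2 : (K.+1 <= 2 * K)%N by rewrite mul2n -addnn -addn1 leq_add2l.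
    rewrite -!natrM ler_nat; apply: leq_trans (ltnW (ltn_ceil k D0)) _.
    by rewrite -/K mulnAC leq_mul2r K2 orbT.
  lra.
(* If some bin is poorly filled, the trivial bound [rho ^ 2] per edge is paid for by the indicator
   of that bin. *)
rewrite negb_forall => /existsP[t]; rewrite -ltnNge => tlow.
have [Q [sQ Qr] _] := exists_block_approximation gW lipW M0 a0 rho0 x01 zsurj
  (fun i j _ => x1 i j).
have c0 : 0 <= 64 * M ^+ 2 * D%:R ^+ 2 * (k%:R^-1 `^ a) ^+ 2 by rewrite !mulr_ge0 ?sqr_ge0.
exists Q, z; split => //; apply: sum_edges_le => [|e].
  by rewrite mulr_ge0 ?sqr_ge0 ?addr_ge0.
have /andP[q0 q1] := Qr (z (val e).1) (z (val e).2).
have := graphon_unit gW (x01 (val e).1) (x01 (val e).2); rewrite in_itv /= => /andP[w0 w1].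
apply: (@le_trans _ _ (rho ^+ 2 * 1)).
  rewrite mulr1 -[leLHS]real_normK ?num_real // lerXn2r ?nnegrE // ler_norml.
  have : 0 <= rho * W (x (val e).1, x (val e).2) <= rho.
    by rewrite mulr_ge0 //= ler_piMr.
  move: q0 q1; clear; move: (Q _ _) (rho * _) => q v q0 q1 /andP[v0 v1].
  by apply/andP; split; lra.
rewrite ler_wpM2l ?sqr_ge0 // -[leLHS]add0r; apply: lerD => //.
rewrite (bigD1 t) //= tlow lerDl; exact: sumr_ge0.
Qed.

Lemma integral_affine_indic d (T : measurableType d) (R : realType)
    (P : probability T R) (K : nat) (E : 'I_K -> set T) (u v q : R) :
  0 <= u -> 0 <= v -> (forall t, measurable (E t)) ->
  (forall t, (P (E t) <= q%:E)%E) ->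
  (\int[P]_w (u + v * \sum_t \1_(E t) w)%:E <= (u + v * (K%:R * q))%:E)%E.
Proof.
move=> u0 v0 mE PE.
have mI t : measurable_fun setT (\1_(E t) : T -> R) by exact: measurable_indic.
have S0 w : 0 <= \sum_t \1_(E t) w :> R by exact: sumr_ge0.
have mS : measurable_fun setT (fun w => \sum_t \1_(E t) w : R).
  by apply: measurable_sum => t; exact: mI.
under eq_integral do rewrite EFinD.
rewrite ge0_integralD //; last 2 first.
- by move=> w _; rewrite lee_fin mulr_ge0.
- by apply/measurable_EFinP; exact: measurable_funM.
rewrite integral_cst // [X in (_ * X)%E]probability_setT mule1 EFinD leeD2l //.
under eq_integral do rewrite EFinM.
rewrite ge0_integralZl_EFin //; last 2 first.
- by move=> w _; rewrite lee_fin.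
- by apply/measurable_EFinP.
rewrite EFinM lee_wpmul2l ?lee_fin //.
under eq_integral do rewrite -sumEFin.
rewrite ge0_integral_sum //; last by move=> t; apply/measurable_EFinP.
apply: (@le_trans _ _ (\sum_(t < K) q%:E)%E).
  by apply: lee_sum => t _; rewrite integral_indic // setIT; exact: PE.
by rewrite sumEFin lee_fin sumr_const card_ord mulr_natl.
Qed.

Lemma error_rate_mono (R : realType) (alpha rho r : R) (n : nat) :
  0 < alpha -> 0 < rho -> rho <= r -> 1 <= ln (rho * n%:R) ->
  error_rate alpha rho rho n <= error_rate alpha rho r n.
Proof.
move=> alpha0 rho0 rhor l1; rewrite /error_rate.
have a0 : 0 < Num.min alpha 1 by rewrite lt_min alpha0 ltr01.
apply: lerD.
  rewrite ler_wpM2r ?powR_ge0 // ge0_ler_powR ?nnegrE ?divr_ge0 //; lra.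
by rewrite -!mulrA ler_wpM2r // divr_ge0 //; lra.
Qed.

(** As [k] is at most twice [block_scale], the term in [k ^ 2] is at most 4 times the first part of
    the rate. The term in [n * ln k] is at most [1 + a^-1] times the logarithmic part, which also
    absorbs the remaining 1. *)
Lemma stochastic_error_rate (R : realType) (alpha rho r C : R) (n : nat) :
  0 < alpha -> (0 < n)%N -> 4 / n%:R < rho -> rho <= 1 -> rho <= r -> 0 <= C ->
  let k := num_blocks alpha rho n in (k <= n)%N ->
  2 / n%:R ^+ 2 * (r * (C * (n%:R * ln k%:R + k%:R ^+ 2 + 1))) <=
  2 * C * (6 + (Num.min alpha 1)^-1) * error_rate alpha rho r n.
Proof.
move=> alpha0 n0 rho4 rho1 rhor C0 k kn.
set a := Num.min alpha 1; have a0 : 0 < a by rewrite lt_min alpha0 ltr01.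
have n0' : 0 < n%:R :> R by rewrite ltr0n.
have n1 : 1 <= n%:R :> R by rewrite ler1n.
have rho0 : 0 < rho by apply: lt_trans rho4; rewrite divr_gt0.
have r0 : 0 < r by exact: lt_le_trans rhor.
have [k2 l1 kk _ /(_ kn) lk] := num_blocks_bounds alpha0 n0 rho4 rho1.
rewrite -/k -/a in k2 kk lk *.
have T1 := block_scale_rate a0 n0 rho0 rhor.
rewrite /error_rate -/a; set t1 := _ `^ _ * _ in T1 *; set t2 := _ / n%:R.
have b1 : r * k%:R ^+ 2 / n%:R ^+ 2 <= 4 * t1.
  have h : k%:R ^+ 2 <= (2 * block_scale a rho n) ^+ 2.
    by rewrite lerXn2r ?nnegrE ?mulr_ge0 ?powR_ge0.
  apply: (@le_trans _ _ (4 * (r * block_scale a rho n ^+ 2 / n%:R ^+ 2))); last first.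
    by rewrite ler_pM2l.
  rewrite [leRHS]mulrA ler_wpM2r ?invr_ge0 ?sqr_ge0 // [leRHS]mulrCA ler_wpM2l ?(ltW r0) //.
  by move: h; rewrite exprMn; lra.
have b2 : r * ln k%:R / n%:R <= (1 + a^-1) * t2.
  rewrite /t2 [leRHS]mulrA ler_wpM2r ?invr_ge0 ?ler0n // [leRHS]mulrCA.
  by rewrite ler_wpM2l // ltW.
have b3 : r / n%:R ^+ 2 <= t2.
  rewrite expr2 invfM mulrA /t2 ler_wpM2r ?invr_ge0 ?ler0n //.
  by rewrite ler_wpM2l ?(ltW r0) //; apply: le_trans l1; rewrite invf_le1.
have t10 : 0 <= t1 by rewrite mulr_ge0 ?powR_ge0.
have t20 : 0 <= t2 by rewrite !mulr_ge0 ?invr_ge0 ?ler0n //; lra.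
have ai0 : 0 <= a^-1 by rewrite invr_ge0 ltW.
have -> : 2 / n%:R ^+ 2 * (r * (C * (n%:R * ln k%:R + k%:R ^+ 2 + 1))) =
   2 * C * (r * ln k%:R / n%:R + r * k%:R ^+ 2 / n%:R ^+ 2 + r / n%:R ^+ 2).
  by field; rewrite gt_eqF.
rewrite -[leRHS]mulrA ler_wpM2l ?mulr_ge0 //.
have := mulr_ge0 ai0 t10; rewrite mulrDl in b2; lra.
Qed.

(** The constraint bounds the entries by [r], so all data are good and there is no exceptional
    event. *)
Lemma restricted_least_squares_rate (R : realType) (alpha L : R) :
  0 < alpha -> 0 < L -> exists2 C : R, 0 < C &
    forall (n : nat) (rho r : R) (W0 : R * R -> R)
      (d : measure_display) (T : measurableType d) (P : probability T R)
      (xi : 'I_n -> {RV P >-> R}) (A : T -> data n),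
    (0 < n)%N -> graphon W0 -> holder_class alpha L W0 ->
    4 / n%:R < rho -> rho <= 1 -> sparse_graphon_model rho W0 xi A -> rho <= r ->
    forall est : data n ->
        'M[R]_(num_blocks alpha rho n) * {ffun 'I_n -> 'I_(num_blocks alpha rho n)},
    is_restricted_least_squares r est ->
    (mean_sq_error rho W0 xi A est <= (C * error_rate alpha rho r n)%:E)%E.
Proof.
move=> alpha0 L0; have [M M0 lip] := holder_class_lipschitz alpha0 L0.
set a := Num.min alpha 1; have a0 : 0 < a by rewrite lt_min alpha0 ltr01.
have C1 : 0 <= risk_const R.
  by rewrite addr_ge0 ?mulr_ge0 // ln_ge0 // grid_const_ge1.
have C2 : 0 <= 2 * risk_const R * (6 + a^-1).
  by rewrite !mulr_ge0 // addr_ge0 // invr_ge0 ltW.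
have C3 : 0 <= 16 * M ^+ 2 by rewrite mulr_ge0 ?sqr_ge0.
exists (16 * M ^+ 2 + 2 * risk_const R * (6 + a^-1) + 1); first by lra.
move=> n rho r W d T P xi A n0 gW hW rho4 rho1 model rhor est estP.
set k := num_blocks alpha rho n in est estP *.
have n0' : 0 < n%:R :> R by rewrite ltr0n.
have rho0 : 0 < rho by apply: lt_trans rho4; rewrite divr_gt0.
have r0 : 0 < r by exact: lt_le_trans rhor.
have [k2 l1 _ bias _] := num_blocks_bounds alpha0 n0 rho4 rho1.
rewrite -/k -/a in k2 bias.
have k0 : (0 < k)%N by exact: leq_trans k2.
(* The estimate at any one value of the data is a map onto the [k] labels, whence [k <= n]. *)
have kn : (k <= n)%N.
  have [_ zZ _] := estP [ffun=> true].
  move: zZ; rewrite inE => /forallP fib.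
  have /fin_all_exists[g hg] : forall b, exists i, (est [ffun=> true]).2 i = b.
    move=> b; have /card_gt0P[i] := fib b; rewrite inE => /eqP <-; by exists i.
  rewrite -[leqLHS](card_ord k) -[leqRHS](card_ord n).
  by apply: (@leq_card _ _ g) => b c bc; rewrite -(hg b) bc hg.
have rate0 : 0 <= error_rate alpha rho r n.
  rewrite /error_rate addr_ge0 ?mulr_ge0 ?powR_ge0 ?invr_ge0 ?ler0n //; lra.
pose h : R := (16 * M ^+ 2 + 2 * risk_const R * (6 + a^-1) + 1) * error_rate alpha rho r n.
suff : (mean_sq_error rho W xi A est <= \int[P]_w (h%:E))%E.
  by rewrite integral_cst // [X in (_ * X)%E]probability_setT mule1.
apply: (mean_sq_error_le gW _ model) => //; first by rewrite ltW.
move=> w; have xi01 i := xi_unit model i w.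
set th := fun e : edge n => rho * W (xi (val e).1 w, xi (val e).2 w).
have W01 (e : edge n) : 0 <= W (xi (val e).1 w, xi (val e).2 w) <= 1.
  by have := graphon_unit gW (xi01 (val e).1) (xi01 (val e).2); rewrite in_itv.
have th0 e : 0 <= th e by have /andP[? _] := W01 e; rewrite mulr_ge0 // ltW.
have thrho e : th e <= rho.
  by have /andP[_ ?] := W01 e; rewrite ler_piMr // ltW.
have [Q [z [sQ Qr zZ hQ]]] := surjective_approximation gW (lip W hW) M0 (ltW a0)
  (ltW rho0) xi01 k0 kn.
have th01 e : 0 <= th e <= 1 by rewrite th0 (le_trans (thrho e)).
have thr e : th e <= r by exact: le_trans (thrho e) rhor.
have Q01 b c : 0 <= Q b c <= 1.
  by have /andP[-> ?] := Qr b c; rewrite (le_trans _ rho1).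
have QQ : bounded_sym_matrices r Q.
  split=> // b c; have /andP[? ?] := Qr b c.
  by rewrite ger0_norm // (le_trans _ rhor).
have bnd a' : xpredT a' -> forall b c, `|(est a').1 b c| <= r.
  by move=> _ b c; have [[_ ]] := estP a'.
have nobad a' : ~~ xpredT a' -> forall b c, 0 <= (est a').1 b c <= 1 by [].
have := least_squares_risk r0 k0 th01 thr estP QQ zZ Q01 bnd nobad.
have -> : \sum_(a' | ~~ xpredT a') bernoulli_weight th a' = 0 by rewrite big_pred0.
rewrite mulr0 addr0 => risk.
have c2 : 0 <= 2 / n%:R ^+ 2 :> R by rewrite divr_ge0 ?sqr_ge0.
apply: le_trans (ler_wpM2l c2 risk) _.
have st := stochastic_error_rate alpha0 n0 rho4 rho1 rhor C1 kn.
have mono := error_rate_mono alpha0 rho0 rhor l1.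
have st' : 2 / n%:R ^+ 2 * (2 * \sum_(e : edge n) (Q (z (val e).1) (z (val e).2) - th e) ^+ 2)
    <= 16 * M ^+ 2 * error_rate alpha rho r n.
  apply: (@le_trans _ _ (16 * M ^+ 2 * (rho ^+ 2 * (k%:R^-1 `^ a) ^+ 2))); last first.
    by rewrite ler_wpM2l // (le_trans bias).
  have two : 0 <= 2 :> R by [].
  apply: (le_trans (ler_wpM2l c2 (ler_wpM2l two hQ))).
  by rewrite le_eqVlt; apply/orP; left; apply/eqP; rewrite -/a; field; rewrite gt_eqF.
rewrite mulrDr; apply: (le_trans (lerD st' st)).
by rewrite -/a /h -mulrDl ler_wpM2r // lerDl ler01.
Qed.

(** * Rate of the unrestricted estimator *)

Lemma succn_le_sqr (k : nat) : (2 <= k)%N -> (k.+1 <= k ^ 2)%N.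
Proof. by move=> k2; rewrite -mulnn; nia. Qed.

(** The lower bound on [rho] gives [k * ln k = O(rho * n)], and [n <= 2 * k * n0] turns this into
    [ln k = O(rho * n0)]. The last bound lets the small probability of a dense cut absorb the number
    of edges. *)
Lemma num_blocks_balanced (R : realType) (alpha rho : R) (n n0 : nat) :
  0 < alpha -> (0 < n)%N -> 4 / n%:R < rho -> rho <= 1 ->
  let a := Num.min alpha 1 in let k := num_blocks alpha rho n in
  n%:R `^ (- (2 * a / (1 + 2 * a)))
    * ln (n%:R * rho) `^ (2 * (1 + a) / (1 + 2 * a)) <= rho ->
  (2 <= n0)%N -> k = (n %/ n0)%N ->
  [/\ ln k%:R <= 4 * (1 + a^-1) * (rho * n0%:R), 1 <= 2 * ln k%:R :> R,
     ln k.+1%:R <= 2 * ln k%:R :> R & n%:R ^+ 2 <= expR (4 * n0%:R * ln k%:R) :> R].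
Proof.
move=> alpha0 n_gt0 rho4 rho1 a k hrho n02 kE.
have a0 : 0 < a by rewrite lt_min alpha0 ltr01.
have ai0 : 0 < a^-1 by rewrite invr_gt0.
have n0' : 0 < n%:R :> R by rewrite ltr0n.
have rho0 : 0 < rho by apply: lt_trans rho4; rewrite divr_gt0.
have [k2 l1 kk _] := num_blocks_bounds alpha0 n_gt0 rho4 rho1.
rewrite -/k -/a in k2 kk *.
have n00 : (0 < n0)%N by exact: leq_trans n02.
have kn : (k * n0 <= n)%N by rewrite kE leq_divM.
have nk : (n < k.+1 * n0)%N by rewrite kE ltn_ceil.
have kn' : (k <= n)%N by apply: leq_trans kn; rewrite leq_pmulr.
move=> /(_ kn') lk.
have kap := block_scale_log a0 n_gt0 rho0 l1 hrho.
have k0 : 0 < k%:R :> R by rewrite ltr0n (leq_trans _ k2).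
have lnk0 : 0 <= ln k%:R :> R by rewrite ln_ge0 // ler1n (leq_trans _ k2).
have ln2 : 1 <= 2 * ln 2 :> R.
  have : expR (1 / 2) <= 2 :> R.
    by apply: le_trans (expR_le_quadratic (lexx _)) _; lra.
  rewrite -ler_ln ?posrE ?expR_gt0 // expRK; lra.
have ln2k : ln 2 <= ln k%:R :> R by rewrite ler_ln ?posrE // ler_nat.
have lnS : ln k.+1%:R <= 2 * ln k%:R :> R.
  rewrite mulr_natl -lnXn // ler_ln ?posrE ?ltr0n ?exprn_gt0 //.
  by rewrite -natrX ler_nat succn_le_sqr.
split => //; last 1 first.
(* [n <= (k + 1) * n0 <= k ^ 2 * 2 ^ n0 <= k ^ (2 + n0)], and [2 + n0 <= 2 * n0]. *)
- have nk2 : (n <= k ^ (2 * n0))%N.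
    apply: (@leq_trans (k ^ (2 + n0))%N); last first.
      by rewrite leq_pexp2l ?(leq_trans _ k2) // mul2n -addnn leq_add2r.
    rewrite expnD; apply: leq_trans (ltnW nk) _; apply: leq_mul.
      exact: succn_le_sqr.
    apply: ltnW; apply: leq_trans (ltn_expl n0 (isT : 1 < 2)%N) _.
    by rewrite leq_exp2r.
  have : n%:R ^+ 2 <= (k%:R ^+ (2 * n0)) ^+ 2 :> R.
    by rewrite lerXn2r ?nnegrE ?exprn_ge0 // -natrX ler_nat.
  move=> h; apply: (le_trans h); rewrite -exprM.
  have -> : 4 * n0%:R * ln k%:R = (2 * n0 * 2)%N%:R * ln k%:R :> R.
    by rewrite !natrM; ring.
  by rewrite expRM_natl lnK ?posrE.
- have n2k : n%:R <= 2 * k%:R * n0%:R :> R.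
    rewrite -!natrM ler_nat; apply: leq_trans (ltnW nk) _.
    by rewrite leq_mul2r mul2n -addnn -addn1 leq_add2l (leq_trans _ k2) ?orbT.
  have h1 : k%:R * ln k%:R <= 2 * (1 + a^-1) * (rho * n%:R).
    apply: (@le_trans _ _ (2 * block_scale a rho n * ((1 + a^-1) * ln (rho * n%:R)))).
      by rewrite ler_pM // ltW.
    have c0 : 0 <= 2 * (1 + a^-1) by lra.
    by have := ler_wpM2l c0 kap; lra.
  rewrite -(ler_pM2l k0); apply: (le_trans h1).
  have c0 : 0 <= 2 * (1 + a^-1) * rho by rewrite !mulr_ge0 ?(ltW rho0) //; lra.
  by have := ler_wpM2l c0 n2k; lra.
- lra.
Qed.

(** With [K] bins, a bin holds [n / K >= D * n0] points on average. The condition on [D] makes the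
    exponent at most [- 3 * ln k], so that the sum over at most [k] bins is at most [k ^ -2]. *)
Lemma low_bins_mass (R : realType) (n n0 k D : nat) (a c rho : R) :
  a <= 1 -> 1 <= c -> 0 <= rho -> rho <= 1 -> (0 < D)%N -> 4 + 24 * c <= D%:R ->
  (0 < k)%N -> (k * n0 <= n)%N -> 0 <= ln k%:R :> R ->
  ln k%:R <= 4 * c * (rho * n0%:R) ->
  (k %/ D)%N%:R * expR ((2 * n0)%:R - n%:R / (2 * (k %/ D)%N%:R)) <=
  (k%:R^-1 `^ a) ^+ 2 :> R.
Proof.
move=> a1 c1 rho0 rho1 D0 D1 k0 kn0 lk0 lk.
have k0' : 0 < k%:R :> R by rewrite ltr0n.
have e2 : expR (- (2 * ln k%:R)) <= (k%:R^-1 `^ a) ^+ 2.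
  rewrite powR_expR_ln ?invr_gt0 // -expRM_natl ler_expR lnV ?posrE //.
  have := ler_wpM2r lk0 a1; lra.
move: (k %/ D)%N (leq_divM k D) (leq_div k D) => K KD Kk.
have [->|K0] := posnP K; first by rewrite mul0r sqr_ge0.
apply: le_trans e2; apply: (@le_trans _ _ (k%:R * expR (- (3 * ln k%:R)))); last first.
  by rewrite -{1}[k%:R](@lnK R) ?posrE // -expRD ler_expR; lra.
have K0' : 0 < K%:R :> R by rewrite ltr0n.
rewrite ler_pM ?expR_ge0 ?ler0n ?ler_nat // ler_expR.
have h1 : K%:R * D%:R * n0%:R <= n%:R :> R.
  rewrite -!natrM ler_nat; apply: leq_trans kn0.
  by rewrite leq_mul2r KD orbT.
have h2 : D%:R * n0%:R / 2 <= n%:R / (2 * K%:R) :> R.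
  rewrite ler_pdivlMr ?mulr_gt0 //; lra.
have h3 : (4 + 24 * c) * n0%:R <= D%:R * n0%:R by rewrite ler_wpM2r.
have h4 : rho * n0%:R <= n0%:R by rewrite ler_piMl.
have h5 : c * (rho * n0%:R) <= c * n0%:R by rewrite ler_wpM2l //; lra.
rewrite natrM; lra.
Qed.

(** The oracle inequality at fixed latent points, the good data being those without dense cuts. The
    indicators of poorly filled bins remain in the bound until the latent points are integrated
    out. *)
Lemma least_squares_pointwise (R : realType) (n k n0 D : nat) (W : R * R -> R)
    (M a rho r : R) (x : 'I_n -> R)
    (est : data n -> 'M[R]_k * {ffun 'I_n -> 'I_k}) :
  graphon W ->
  (forall x y x' y', x \in `[0, 1] -> y \in `[0, 1] -> x' \in `[0, 1] -> y' \in `[0, 1] ->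
    `|W (x', y') - W (x, y)| <= M * (`|x' - x| `^ a + `|y' - y| `^ a)) ->
  0 <= M -> 0 <= a <= 1 -> 0 < rho -> rho <= 1 -> 4 * rho <= r ->
  (forall i, x i \in `[0, 1]) -> (0 < n)%N -> (0 < k)%N -> (2 <= n0)%N ->
  k = (n %/ n0)%N -> (0 < D)%N -> 1 <= 2 * ln k%:R :> R ->
  8 * ln k%:R <= r * n0%:R / 32 - ln k.+1%:R ->
  n%:R ^+ 2 <= expR (4 * n0%:R * ln k%:R) :> R ->
  is_least_squares n0 est ->
  2 / n%:R ^+ 2 * (\sum_a' bernoulli_weight
       (fun e : edge n => rho * W (x (val e).1, x (val e).2)) a' *
     \sum_(e : edge n) ((est a').1 ((est a').2 (val e).1) ((est a').2 (val e).2)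
        - rho * W (x (val e).1, x (val e).2)) ^+ 2) <=
  256 * M ^+ 2 * D%:R ^+ 2 * (rho ^+ 2 * (k%:R^-1 `^ a) ^+ 2) +
  4 * rho ^+ 2 * \sum_(t < k %/ D) (bin_count x t < 2 * n0)%N%:R +
  2 / n%:R ^+ 2 * (r * (risk_const R * (n%:R * ln k%:R + k%:R ^+ 2 + 1))) + 10 / n%:R ^+ 2.
Proof.
move=> gW lipW M0 a01 rho0 rho1 rhor x01 n_gt0 k0 n02 kE D0 ln2 s8 n2 estP.
set th := fun e : edge n => rho * W (x (val e).1, x (val e).2).
have n0' : 0 < n%:R :> R by rewrite ltr0n.
have n00 : (0 < n0)%N by exact: leq_trans n02.
have r0 : 0 < r by lra.
have nk : (n <= k.+1 * n0)%N by rewrite kE ltnW // ltn_ceil.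
have W01 (e : edge n) : 0 <= W (x (val e).1, x (val e).2) <= 1.
  by have := graphon_unit gW (x01 (val e).1) (x01 (val e).2); rewrite in_itv.
have th0 e : 0 <= th e by have /andP[? _] := W01 e; rewrite mulr_ge0 // ltW.
have thrho e : th e <= rho by have /andP[_ ?] := W01 e; rewrite ler_piMr // ltW.
have th01 e : 0 <= th e <= 1 by rewrite th0 (le_trans (thrho e)).
have thr e : th e <= r by apply: le_trans (thrho e) _; lra.
have [Q [z [sQ Qr zZ hQ]]] := balanced_approximation gW lipW M0 a01
  (ltW rho0) x01 k0 n00 kE D0.
have Q01 b c : 0 <= Q b c <= 1.
  by have /andP[-> ?] := Qr b c; rewrite (le_trans _ rho1).
have goodr a' : no_dense_cut n0 r a' -> forall b c, `|(est a').1 b c| <= r.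
  move=> ga b c; have [/andP[q0 _] qr] := least_squares_entries b c r n02 (estP a').
  by rewrite ger0_norm // qr.
have bad01 a' : ~~ no_dense_cut n0 r a' -> forall b c, 0 <= (est a').1 b c <= 1.
  by move=> _ b c; have [] := least_squares_entries b c r n02 (estP a').
have risk := least_squares_risk r0 k0 th01 thr estP sQ zZ Q01 goodr bad01.
have c2 : 0 <= 2 / n%:R ^+ 2 :> R by rewrite divr_ge0 ?sqr_ge0.
have s0 : 0 <= r * n0%:R / 32 - ln k.+1%:R by lra.
have dense := dense_cut_weight th01 thrho rhor (ltW rho0) n02 nk s0.
(* There are at most [n ^ 2 <= expR (4 * n0 * ln k)] edges, against a probability of at most
   [expR (2 * n0 * (1 - 8 * ln k))]; with [1 <= 2 * ln k] the product is at most 1. *)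
have edges : 5 * #|{: edge n}|%:R *
    \sum_(a' | ~~ no_dense_cut n0 r a') bernoulli_weight th a' <= 5.
  rewrite -mulrA -[leRHS]mulr1 ler_pM2l //.
  apply: (@le_trans _ _ (expR (4 * n0%:R * ln k%:R) *
      expR (2 * n0%:R * (1 - (r * n0%:R / 32 - ln k.+1%:R))))).
    apply: ler_pM => //; first by apply: sumr_ge0 => a' _; exact: bernoulli_weight_ge0.
    apply: le_trans n2; rewrite -natrX ler_nat.
    by apply: leq_trans (card_edge_le n); rewrite leq_pmull.
  rewrite -expRD -[leRHS](@expR0 R) ler_expR.
  have n00' : 0 <= n0%:R :> R by rewrite ler0n.
  by move: (ler_wpM2l n00' s8) (ler_wpM2l n00' ln2) (n00'); clear; lra.
have two : 0 <= 2 :> R by [].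
apply: le_trans (ler_wpM2l c2 risk) _.
apply: le_trans (ler_wpM2l c2 (lerD (lerD (ler_wpM2l two hQ) (lexx _)) edges)) _.
move: (\sum_t _) (risk_const R * _) (_ `^ _); clear - n0' => S c e.
by rewrite le_eqVlt; apply/orP; left; apply/eqP; field; rewrite gt_eqF.
Qed.

Lemma error_rate_ge0 (R : realType) (alpha rho s : R) (n : nat) :
  0 <= s -> 1 <= ln (rho * n%:R) -> 0 <= error_rate alpha rho s n.
Proof.
move=> s0 l1; rewrite /error_rate addr_ge0 ?mulr_ge0 ?powR_ge0 ?invr_ge0 ?ler0n //.
exact: le_trans l1.
Qed.

Lemma inv_sqr_le_error_rate (R : realType) (alpha rho : R) (n : nat) :
  (0 < n)%N -> 4 / n%:R < rho -> 1 <= ln (rho * n%:R) ->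
  n%:R ^- 2 <= error_rate alpha rho rho n.
Proof.
move=> n0 rho4 l1; have n0' : 0 < n%:R :> R by rewrite ltr0n.
have i0 : 0 < n%:R^-1 :> R by rewrite invr_gt0.
have rho0 : 0 < rho by apply: lt_trans rho4; rewrite divr_gt0.
apply: (@le_trans _ _ (rho * ln (rho * n%:R) / n%:R)); last first.
  by rewrite /error_rate lerDr mulr_ge0 ?powR_ge0.
rewrite expr2 invfM ler_wpM2r ?(ltW i0) //.
apply: (@le_trans _ _ rho); first by lra.
by rewrite ler_peMr // ltW.
Qed.

Lemma least_squares_rate (R : realType) (alpha L : R) :
  0 < alpha -> 0 < L -> exists2 C : R, 0 < C &
    forall (n : nat) (rho : R) (W0 : R * R -> R)
      (d : measure_display) (T : measurableType d) (P : probability T R)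
      (xi : 'I_n -> {RV P >-> R}) (A : T -> data n),
    (0 < n)%N -> graphon W0 -> holder_class alpha L W0 ->
    4 / n%:R < rho -> rho <= 1 -> sparse_graphon_model rho W0 xi A ->
    let a := Num.min alpha 1 in
    n%:R `^ (- (2 * a / (1 + 2 * a)))
      * ln (n%:R * rho) `^ (2 * (1 + a) / (1 + 2 * a)) <= rho ->
    forall n0 : nat, (2 <= n0)%N -> num_blocks alpha rho n = (n %/ n0)%N ->
    forall est : data n ->
        'M[R]_(num_blocks alpha rho n) * {ffun 'I_n -> 'I_(num_blocks alpha rho n)},
    is_least_squares n0 est ->
    (mean_sq_error rho W0 xi A est <= (C * error_rate alpha rho rho n)%:E)%E.
Proof.
move=> alpha0 L0; have [M M0 lip] := holder_class_lipschitz alpha0 L0.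
pose a := Num.min alpha 1; have a0 : 0 < a by rewrite lt_min alpha0 ltr01.
have a1 : a <= 1 by rewrite ge_min lexx orbT.
have ai0 : 0 < a^-1 by rewrite invr_gt0.
have [Ca CaE] : {c | c = 1 + a^-1} by exists (1 + a^-1).
have Ca1 : 1 <= Ca by lra.
(* With [r = B * rho] and [ln k <= 4 * Ca * (rho * n0)], the value 1280 gives [r * n0 / 32 >= 10 *
   ln k >= 8 * ln k + ln k.+1]. *)
have [B BE] : {b | b = 1280 * Ca} by exists (1280 * Ca).
have [D D1] : exists D, 4 + 24 * Ca <= D.+1%:R.
  by exists (Num.truncn (4 + 24 * Ca)); rewrite ltW // truncnS_gt.
have {D D1} [D D0 D1] : exists2 D, (0 < D)%N & 4 + 24 * Ca <= D%:R by exists D.+1.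
have C1 : 0 <= risk_const R.
  by rewrite addr_ge0 ?mulr_ge0 // ln_ge0 // grid_const_ge1.
have B4 : 4 <= B by lra.
have B0 : 0 < B by lra.
have [c1 c1E] : {c | c = risk_const R} by exists (risk_const R).
have c10 : 0 <= c1 by rewrite c1E.
have [F1 F1E] : {f | f = 256 * M ^+ 2 * D%:R ^+ 2} by exists (256 * M ^+ 2 * D%:R ^+ 2).
have [F2 F2E] : {f | f = B * (2 * c1 * (6 + a^-1))} by exists (B * (2 * c1 * (6 + a^-1))).
have F10 : 0 <= F1.
  have c0 : 0 <= 256 :> R by rewrite ler0n.
  by rewrite F1E; apply: mulr_ge0 (mulr_ge0 c0 (sqr_ge0 _)) (sqr_ge0 _).
have F20 : 0 <= F2 by rewrite F2E !mulr_ge0 ?(ltW B0) // addr_ge0 // ltW.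
exists (F1 + 4 + F2 + 10); first by lra.
move=> n rho W d T P xi A n_gt0 gW hW rho4 rho1 model /= hrho n0 n02 kE est estP.
have [k2 l1 _ bias _] := num_blocks_bounds alpha0 n_gt0 rho4 rho1.
have [lk ln2 lnS n2] := num_blocks_balanced alpha0 n_gt0 rho4 rho1 hrho n02 kE.
have st' := stochastic_error_rate alpha0 n_gt0 rho4 rho1 (lexx rho) C1.
clear hrho; move: est estP k2 kE bias lk ln2 lnS n2 st'; rewrite -/a -CaE -c1E.
move: (num_blocks alpha rho n) => k est estP k2 kE bias lk ln2 lnS n2 st'.
have rho0 : 0 < rho by apply: lt_trans rho4; rewrite divr_gt0 // ltr0n.
have b3 := inv_sqr_le_error_rate alpha n_gt0 rho4 l1.
have rate0 := error_rate_ge0 alpha (ltW rho0) l1.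
have k0 : (0 < k)%N by exact: leq_trans k2.
have kn0 : (k * n0 <= n)%N by rewrite kE leq_divM.
have kn : (k <= n)%N.
  by apply: leq_trans kn0; rewrite leq_pmulr // (leq_trans _ n02).
have {st'} st := st' kn.
have [r rE] : {r | r = B * rho} by exists (B * rho).
have rhor : 4 * rho <= r by rewrite rE ler_wpM2r // ltW.
have s8 : 8 * ln k%:R <= r * n0%:R / 32 - ln k.+1%:R.
  by move: lk lnS; rewrite rE BE; clear; lra.
have [e eE] : {e | e = k%:R^-1 `^ a} by exists (k%:R^-1 `^ a).
rewrite -eE in bias.
have [K KE] : {K | K = (k %/ D)%N} by exists (k %/ D)%N.
have [q qE] : {q : R | q = expR ((2 * n0)%:R - n%:R / (2 * K%:R))} by eexists.
have lk0 : 0 <= ln k%:R :> R by rewrite ln_ge0 // ler1n.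
have Kq : K%:R * q <= e ^+ 2.
  by rewrite qE KE eE; exact: low_bins_mass a1 Ca1 (ltW rho0) rho1 D0 D1 k0 kn0 lk0 lk.
pose E t := [set w | (bin_count (fun i => xi i w) (t : 'I_K) < 2 * n0)%N].
have PE t : measurable (E t) /\ (P (E t) <= q%:E)%E.
  have K0 : (0 < K)%N by apply: leq_ltn_trans (ltn_ord t).
  rewrite qE; exact: (low_bin_count_prob (2 * n0) t K0 model).
have [u uE] : {u : R | u = F1 * (rho ^+ 2 * e ^+ 2) +
    F2 * error_rate alpha rho rho n + 10 / n%:R ^+ 2} by eexists.
have u0 : 0 <= u.
  rewrite uE addr_ge0 ?divr_ge0 ?sqr_ge0 //.
  apply: addr_ge0; apply: mulr_ge0 => //; apply: mulr_ge0; exact: sqr_ge0.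
have v0 : 0 <= 4 * rho ^+ 2 by rewrite mulr_ge0 ?sqr_ge0.
(* [u] gathers the terms free of the latent points; the expected number of poorly filled bins is at
   most [K * q <= e ^+ 2], so their penalty has the order of the bias. *)
apply: (@le_trans _ _ (u + 4 * rho ^+ 2 * (K%:R * q))%:E); last first.
  rewrite lee_fin uE.
  have b4 : 4 * (rho ^+ 2 * e ^+ 2) <= 4 * error_rate alpha rho rho n by rewrite ler_pM2l.
  move: (ler_wpM2l F10 bias) (ler_wpM2l v0 Kq) b3 b4; clear.
  move: (error_rate _ _ _ _) (K%:R * q) (n%:R ^+ 2)^-1 (rho ^+ 2) (e ^+ 2) => *; lra.
apply: le_trans (integral_affine_indic u0 v0 (fun t => (PE t).1) (fun t => (PE t).2)).
apply: (mean_sq_error_le gW _ model); first by rewrite (ltW rho0).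
  apply: measurable_funD => //; apply: measurable_funM => //.
  by apply: measurable_sum => t; apply: measurable_indic; have [] := PE t.
move=> w; have a01 : 0 <= a <= 1 by rewrite (ltW a0).
have := least_squares_pointwise gW (lip W hW) M0 a01 rho0 rho1 rhor
  (fun i => xi_unit model i w) n_gt0 k0 n02 kE D0 ln2 s8 n2 estP.
rewrite -/a -F1E -eE -KE -c1E.
have -> : \sum_(t < K) (bin_count (fun i => xi i w) t < 2 * n0)%N%:R =
    \sum_t \1_(E t) w :> R.
  apply: eq_bigr => t _; rewrite indicE; congr (_%:R); congr nat_of_bool.
  by apply/idP/idP => [h|]; [rewrite mem_set|rewrite inE].
move=> h; apply: (le_trans h); rewrite uE rE.
(* The stochastic term is linear in [r], so its bound at [rho] is multiplied by [B]. *)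
have := ler_wpM2l (ltW B0) st; rewrite [leRHS]mulrA -F2E; clear.
rewrite -[B * rho * _]mulrA [2 / _ * (B * _)]mulrCA.
by move: (B * _) (F1 * _) (F2 * _) (4 * _ * _) (10 / _) => *; lra.
Qed.

Unset Implicit Arguments.
Theorem corollary2p7 (R : realType) (alpha L : R)
    (alpha_gt0 : 0 < alpha) (L_gt0 : 0 < L) :
  (exists2 C : R, 0 < C &
    forall (n : nat) (rho : R) (W0 : R * R -> R)
      (d : measure_display) (T : measurableType d) (P : probability T R)
      (xi : 'I_n -> {RV P >-> R}) (A : T -> data n),
    (0 < n)%N ->
    graphon W0 -> holder_class alpha L W0 ->
    4 / n%:R < rho -> rho <= 1 ->
    sparse_graphon_model rho W0 xi A ->
    let a := Num.min alpha 1 in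
    n%:R `^ (- (2 * a / (1 + 2 * a)))
      * ln (n%:R * rho) `^ (2 * (1 + a) / (1 + 2 * a)) <= rho ->
    forall n0 : nat, (2 <= n0)%N -> num_blocks alpha rho n = (n %/ n0)%N ->
    forall est : data n ->
        'M[R]_(num_blocks alpha rho n) * {ffun 'I_n -> 'I_(num_blocks alpha rho n)},
    is_least_squares n0 est ->
    (mean_sq_error rho W0 xi A est <= (C * error_rate alpha rho rho n)%:E)%E)
  /\
  (forall c0 : R, 0 < c0 -> exists2 C : R, 0 < C &
    forall (n : nat) (rho r : R) (W0 : R * R -> R)
      (d : measure_display) (T : measurableType d) (P : probability T R)
      (xi : 'I_n -> {RV P >-> R}) (A : T -> data n),
    (0 < n)%N ->
    graphon W0 -> holder_class alpha L W0 ->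
    4 / n%:R < rho -> rho <= 1 ->
    sparse_graphon_model rho W0 xi A ->
    r <= 1 -> rho <= r -> c0 / n%:R <= rho ->
    forall est : data n ->
        'M[R]_(num_blocks alpha rho n) * {ffun 'I_n -> 'I_(num_blocks alpha rho n)},
    is_restricted_least_squares r est ->
    (mean_sq_error rho W0 xi A est <= (C * error_rate alpha rho r n)%:E)%E).
Proof.
split.
  have [C C_gt0 rate] := least_squares_rate alpha_gt0 L_gt0.
  by exists C; [exact: C_gt0 | exact: rate].
move=> c0 _; have [C C_gt0 rate] := restricted_least_squares_rate alpha_gt0 L_gt0.
exists C; first exact: C_gt0.
move=> n rho r W0 d T P xi A n_gt0 gW hW rho4 rho1 model _ rhor _.
exact: rate.
Qed.
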